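(* There exists an absolute constant $c>0$ such that for every $\sigma>0$, all integers $d\ge1$, $m\ge1$ and all integers $b_1,\dots,b_m\ge1$, with $B=\sum_{i=1}^m b_i$ and $m'=\frac1d\sum_{i=1}^m\min\{b_i,d\}$, \[ \inf_{\hat\theta\in\mathcal{A}(b_1,\dots,b_m)}\ \sup_{\theta\in[0,1]^d}\mathbb{E}\|\hat\theta-\theta\|^2\ \ge\ \begin{cases} c\cdot 2^{-2B/d}\,d & \text{if } B/d<\log\frac1\sigma+2,\\[2pt] c\cdot\dfrac{d\sigma^2}{B/d-\log\frac1\sigma} & \text{if } \log\frac1\sigma+2\le B/d<\log\frac1\sigma+\max\{m',2\},\\[6pt] c\cdot d\min\left\{\dfrac{\sigma^2}{m'},1\right\} & \text{if } B/d\ge\log\frac1\sigma+\max\{m',2\}. \end{cases} \]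
   Context: $\log$ denotes the base-2 logarithm and $\|\cdot\|$ the Euclidean norm on $\mathbb{R}^d$. Setting: $X_1,\dots,X_m$ are i.i.d. $N_d(\theta,\sigma^2I_d)$ random vectors in $\mathbb{R}^d$, where $\theta\in[0,1]^d$ is unknown and $\sigma>0$ is known; the $i$-th local machine observes $X_i$ only. $\mathcal{A}(b_1,\dots,b_m)$ is the class of distributed protocols with communication budgets $b_1,\dots,b_m$: the $i$-th machine applies a (possibly randomized) map $\Pi_i:\mathbb{R}^d\to\{0,1\}^{b_i}$ to its own observation $X_i$ to produce a transcript $Z_i=\Pi_i(X_i)$ (internal randomness is independent of the data and across machines), and the estimator $\hat\theta=\hat\theta(Z_1,\dots,Z_m)$ is an $\mathbb{R}^d$-valued function (possibly randomized with independent internal randomness) of the transcripts only. The protocol may depend on $\sigma,d,m,b_1,\dots,b_m$ but not on $\theta$. The expectation $\mathbb{E}$ is over the data (for the given $\theta$) and all internal randomness. *)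

(* Defs.v *)
From HB Require Import structures.
From mathcomp Require Import all_boot all_order all_algebra.
From mathcomp Require Import all_classical all_reals all_analysis.

Set Implicit Arguments.
Unset Strict Implicit.
Unset Printing Implicit Defensive.

Import Order.TTheory GRing.Theory Num.Theory.
Import numFieldNormedType.Exports.

Local Open Scope classical_set_scope.
Local Open Scope ring_scope.

Section product_probability.
Context d (T : measurableType d) (R : realType).

Definition tcons n (x : T * n.-tuple T) : n.+1.-tuple T := [tuple of x.1 :: x.2].

Lemma measurable_tcons n : measurable_fun setT (@tcons n).
Proof. by apply: measurable_cons; [exact: measurable_fst|exact: measurable_snd]. Qed.

HB.instance Definition _ n :=
  isMeasurableFun.Build _ _ _ _ (@tcons n) (@measurable_tcons n).

Fixpoint prod_prob n : ('I_n -> probability T R) -> probability (n.-tuple T) R :=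
  match n with
  | 0 => fun=> \d_[tuple]
  | n'.+1 => fun P =>
      distribution (P ord0 \x prod_prob (fun i : 'I_n' => P (lift ord0 i)))%E
        (@tcons n')
  end.

Lemma prod_probE n (P : 'I_n -> probability T R) (A : 'I_n -> set T) :
  (forall i, measurable (A i)) ->
  prod_prob P [set x | forall i, A i (tnth x i)] = (\prod_(i < n) P i (A i))%E.
Proof.
elim: n P A => [|n IH] P A mA.
  rewrite big_ord0 /= diracE mem_set// => -[] //.
rewrite big_ord_recl /= /distribution /pushforward /=.
rewrite -IH// -product_measure1E//; last first.
  have -> : [set x : n.-tuple T | forall i, A (lift ord0 i) (tnth x i)] =
      \bigcap_(i in [set: 'I_n]) ((fun x => tnth x i) @^-1` A (lift ord0 i)).
    by apply/seteqP; split => x H i; [move=> _; exact: H|exact: (H i I)].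
  apply: fin_bigcap_measurable => // i _.
  by rewrite -[X in measurable X]setTI; exact: measurable_tnth.
congr (_ _); apply/seteqP; split => -[a x] /=.
- move=> H; split => /=; first by have := H ord0.
  by move=> i; have := H (lift ord0 i); rewrite tnthS.
- move=> [/= Ha Hx] i; case: (unliftP ord0 i) => [j ->|->].
    by rewrite tnthS.
  by [].
Qed.

End product_probability.

Section protocols.
Context {R : realType} (d m : nat) (b : 'I_m -> nat).

(* [measurableTypeR R] is R with its Borel sigma-algebra. *)
Local Notation Rd := (d.-tuple (measurableTypeR R)).

Definition transcript := {dffun forall i : 'I_m, (b i).-tuple bool}.

(* Internal randomness is modelled by seeds.  All the machines draw their seed
   from one measurable space, each with a law of its own; this is no
   restriction, since finitely many seed spaces embed as the factors of their
   product.  [encode p i (x, u)] is the string sent by machine [i] when it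
   observes [x] and draws the seed [u]; [decode p z v] is the estimate computed
   from the transcripts [z] and the seed [v]. *)
Record protocol := Protocol {
  seed_display : measure_display;
  seed : measurableType seed_display;
  seed_law : 'I_m -> probability seed R;
  encode : forall i : 'I_m, Rd * seed -> (b i).-tuple bool;
  measurable_encode : forall i, measurable_fun setT (encode i);
  dec_seed_display : measure_display;
  dec_seed : measurableType dec_seed_display;
  dec_seed_law : probability dec_seed R;
  decode : transcript -> dec_seed -> Rd;
  measurable_decode : forall z, measurable_fun setT (decode z)
}.

Arguments encode : clear implicits.
Arguments decode : clear implicits.

(* N_d(theta, sigma^2 I_d); [normal_prob] takes the standard deviation. *)
Definition gaussian (theta : Rd) (sigma : R) :
    probability Rd R :=
  prod_prob (fun j => normal_prob (tnth theta j) sigma).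

(* A sample point lists the pair (observation, seed) of each machine, together
   with the seed of the estimator. *)
Local Notation sample p := (m.-tuple (Rd * seed p) * dec_seed p)%type.

Definition sample_law (p : protocol) (sigma : R) (theta : Rd) :
    probability (sample p) R :=
  (prod_prob (fun i => gaussian theta sigma \x seed_law p i)
     \x dec_seed_law p)%E.
Arguments sample_law : clear implicits.

Definition transcripts (p : protocol) (w : sample p) : transcript :=
  [ffun i => encode p i (tnth w.1 i)].

Definition estimate (p : protocol) (w : sample p) : Rd :=
  decode p (transcripts w) w.2.

Definition sq_dist (x y : Rd) : R :=
  \sum_(j < d) (tnth x j - tnth y j) ^+ 2.

Definition risk (p : protocol) (sigma : R) (theta : Rd) : \bar R :=
  ('E_(sample_law p sigma theta)[fun w => sq_dist (estimate w) theta])%E.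

Definition unit_cube : set Rd :=
  [set theta | forall j, 0 <= tnth theta j <= 1].

Definition minimax_risk (sigma : R) : \bar R :=
  ereal_inf [set r | exists p : protocol,
    r = ereal_sup [set risk p sigma theta | theta in unit_cube]].

End protocols.

Definition log2 {R : realType} (x : R) : R := ln x / ln 2.

(* Main.v *)
(* The parameter gets the uniform prior on a fine grid {k/N}^d of the cube.  Two
   inequalities for the Bayes risk rho of an estimator are then combined.

   (1) Gibbs' inequality for the joint law of the parameter and the transcripts,
   against the weights exp(- l^2 |T(z) - theta|^2), gives
     sum_i H(Z_i | theta) <= l^2 rho + B ln 2 + d (ln 8 - ln l):
   an accurate estimator leaves few of the B bits free once theta is known.  As
   the left side is nonnegative, this is the first regime.

   (2) A discrete van Trees inequality bounds rho below by d^2 over the total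
   Fisher information of the transcripts.  The score of a message is a conditional
   mean of the Gaussian noise W given a set A, and |E[W | A]|^2 <= 2 ln (1 / P(A)),
   so that the information carried by Z_i is at most a constant times
   H(Z_i | theta) / sigma^2; it is also at most a constant times d / sigma^2.  The
   third regime follows from H(Z_i | theta) <= b_i ln 2, and the second one from
   (1) with l = 1 / sigma.

   The decoder seed is frozen throughout: the bounds hold for each of its values,
   and finite differences at the scale 1/N replace the derivatives in theta. *)
From HB Require Import structures.
From mathcomp Require Import all_boot all_order all_algebra.
From mathcomp Require Import all_classical all_reals all_analysis.
From mathcomp Require Import measurable_realfun.
From mathcomp Require Import ring lra.
Require Import Defs.

Set Implicit Arguments.
Unset Strict Implicit.
Unset Printing Implicit Defensive.

Import Order.TTheory GRing.Theory Num.Theory.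
Import numFieldNormedType.Exports HBNNSimple.
Local Open Scope ring_scope.

Lemma eq_imp_le disp (T : porderType disp) (x y : T) : x = y -> (x <= y)%O.
Proof. by move->. Qed.

(** * Finite sums and real inequalities *)

Lemma prod_sum_dffun (R : comPzSemiRingType) (I : finType) (T_ : I -> finType)
    (F : forall i, T_ i -> R) :
  \prod_i \sum_(y : T_ i) F i y =
  \sum_(z : {dffun forall i, T_ i}) \prod_i F i (z i).
Proof.
rewrite (reindex (@dffun_of_fprod _ T_)) /=; last exact/onW_bij/dffun_of_fprod_bij.
have -> : \sum_j \prod_i F i (dffun_of_fprod j i) =
    \sum_(j : fprod T_) \prod_(i in I) [ffun x => F i x] (j i).
  by apply: eq_bigr => j _; apply: eq_bigr => i _; rewrite !ffunE.
rewrite (@big_fprod _ _ _ _ (GRing.add : Monoid.add_law _ _)).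
rewrite -(bigA_distr_big_dep _ (fun i j => @untag _ _ _ 0 i [ffun x => F i x] j)).
apply: eq_bigr => i _; rewrite big_tag; apply: eq_bigr => y _.
by congr (untag _ _ _); apply/funext => x; rewrite ffunE.
Qed.

(** Independence: absorb [f] into factor [i] and distribute; every other factor sums to 1. *)
Lemma sum_dffun_marginal (R : comPzSemiRingType) (I : finType) (T_ : I -> finType)
    (p f : forall i, T_ i -> R) (i : I) :
  (forall l, \sum_y p l y = 1) ->
  \sum_(z : {dffun forall i, T_ i}) (\prod_l p l (z l)) * f i (z i) =
  \sum_y p i y * f i y.
Proof.
move=> p1.
pose F l y := p l y * (if l == i then f l y else 1).
transitivity (\sum_(z : {dffun forall i, T_ i}) \prod_l F l (z l)).
  apply: eq_bigr => z _; rewrite big_split /=; congr (_ * _).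
  rewrite (bigD1 i) //= eqxx big1 ?mulr1// => l /negbTE ->//.
rewrite -prod_sum_dffun (bigD1 i) //= [X in _ * X]big1 ?mulr1.
  by apply: eq_bigr => y _; rewrite /F eqxx.
move=> l /negbTE li; rewrite -[RHS](p1 l); apply: eq_bigr => y _.
by rewrite /F li mulr1.
Qed.

Section real_inequalities.
Context {R : realType}.
Implicit Types x y u v : R.

(** The weighted sum of the squares of [C * f i - B * g i] equals [C * (A * C - B ^+ 2)]. If
    [C = 0], each [p i * g i ^+ 2] vanishes and so does [B]. *)
Lemma sum_CauchySchwarz (I : finType) (p f g : I -> R) :
  (forall i, 0 <= p i) ->
  (\sum_i p i * (f i * g i)) ^+ 2 <=
  (\sum_i p i * f i ^+ 2) * (\sum_i p i * g i ^+ 2).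
Proof.
move=> p0; set A := \sum_i p i * f i ^+ 2; set C := \sum_i p i * g i ^+ 2.
set B := \sum_i _.
have tC i : 0 <= p i * g i ^+ 2 by rewrite mulr_ge0 ?sqr_ge0.
have := sumr_ge0 (index_enum I) (fun i (_ : true) => tC i);
  rewrite -/C le_eqVlt => /orP[/eqP C0|C0].
  have -> : B = 0.
    apply: big1 => i _.
    have /eqP : p i * g i ^+ 2 = 0.
      by apply/eqP; move: (esym C0) => /eqP; rewrite psumr_eq0 // => /allP; apply;
        rewrite mem_index_enum.
    by rewrite mulf_eq0 sqrf_eq0 => /orP[] /eqP ->; rewrite ?mul0r ?mulr0.
  by rewrite expr0n -C0 mulr0.
have : 0 <= \sum_i p i * (C * f i - B * g i) ^+ 2.
  by apply: sumr_ge0 => i _; rewrite mulr_ge0 ?sqr_ge0.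
have -> : \sum_i p i * (C * f i - B * g i) ^+ 2 = C * (A * C - B ^+ 2).
  transitivity (\sum_i (C ^+ 2 * (p i * f i ^+ 2) - 2 * C * B * (p i * (f i * g i)) +
    B ^+ 2 * (p i * g i ^+ 2))).
    by apply: eq_bigr => i _; ring.
  rewrite big_split sumrB /= -!mulr_sumr -/A -/B -/C; ring.
by rewrite pmulr_rge0 // subr_ge0.
Qed.

Lemma ln_le_subr1 x : 0 < x -> ln x <= x - 1.
Proof. by move=> x0; have := expR_ge1Dx (ln x); rewrite lnK ?posrE //; lra. Qed.

(** Sum [ln x <= x - 1] at [x = n * r i / (S * p i)] with weights [p i]. Neither family is
    normalized: [p] will be a joint law whose mass is the number of grid points. *)
Lemma gibbs (I : finType) (p r : I -> R) :
  (forall i, 0 <= p i) -> (forall i, 0 < r i) -> 0 < \sum_i p i ->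
  \sum_i - (p i * ln (p i)) <=
  \sum_i - (p i * ln (r i)) + (\sum_i p i) * (ln (\sum_i r i) - ln (\sum_i p i)).
Proof.
move=> p0 r0 n0; set n := \sum_i p i in n0 *; set S := \sum_i r i.
have S0 : 0 < S.
  rewrite lt_def sumr_ge0 ?andbT; last by move=> i _; exact: ltW.
  apply: contraTneq n0 => /eqP; rewrite psumr_eq0 => [/allP h|i _]; last exact: ltW.
  by rewrite /n big1 ?ltxx // => i _; have /implyP := h i (mem_index_enum i);
    rewrite gt_eqF // => /(_ isT).
suff h i : p i * (ln (r i) - ln (p i) + ln n - ln S) <= n * r i / S - p i.
  have := ler_sum (index_enum I) (fun i (_ : true) => h i);
    rewrite sumrB -mulr_suml -mulr_sumr -/S -/n.
  rewrite mulfK ?gt_eqF // subrr => H.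
  rewrite -subr_ge0 -oppr_le0; apply: le_trans H; apply: eq_imp_le.
  transitivity (\sum_i (p i * ln (r i) - p i * ln (p i) + p i * (ln n - ln S)));
    last first.
    by apply: eq_bigr => i _; ring.
  by rewrite big_split sumrB /= -mulr_suml -/n !sumrN; ring.
have := p0 i; rewrite le_eqVlt => /orP[/eqP <-|pi0].
  by rewrite mul0r subr0 divr_ge0 ?mulr_ge0 ?ltW.
have q0 : 0 < n * r i / S / p i by rewrite !divr_gt0 ?mulr_gt0.
have -> : n * r i / S - p i = p i * (n * r i / S / p i - 1) by field;
  rewrite ?gt_eqF //.
rewrite ler_pM2l //; apply: le_trans (ln_le_subr1 q0).
rewrite !lnM ?posrE ?invr_gt0 ?mulr_gt0 ?divr_gt0 ?invr_gt0 ?mulr_gt0 // !lnV ?posrE //.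
by apply: eq_imp_le; ring.
Qed.

Lemma expR_le_inv u : 0 <= u -> expR (- u) <= (1 + u)^-1.
Proof.
by move=> u0; rewrite expRN lef_pV2 ?posrE ?expR_gt0 ?expR_ge1Dx //; lra.
Qed.

(* A bounded increasing function whose increments dominate the Gaussian. *)
Let Phi u := u / (1 + `|u|).

Let Phi_bound u : `|Phi u| <= 1.
Proof.
have h : 0 < 1 + `|u| by have := normr_ge0 u; lra.
by rewrite normrM normfV (gtr0_norm h) ler_pdivrMr // mul1r; lra.
Qed.

(** With [v = u + beta], the increment of [Phi] is at least [beta / ((1 + |u|) (1 + |v|))]. As
    [(1 + |u|) (2 + |u|) <= 4 (1 + u^2)], it dominates [(1 + u^2)^-1], which lies above the
    Gaussian. *)
Let Phi_incr u beta : 0 < beta <= 1 ->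
  expR (- u ^+ 2) <= 4 / beta * (Phi (u + beta) - Phi u).
Proof.
move=> /andP[b0 b1]; apply: le_trans (expR_le_inv (sqr_ge0 _)) _.
set v := u + beta.
have nu := normr_ge0 u; have nv := normr_ge0 v.
have hv : `|v| <= `|u| + 1 by apply: le_trans (ler_normD _ _) _;
  rewrite (gtr0_norm b0); lra.
have -> : Phi v - Phi u = (v - u + (v * `|u| - u * `|v|)) / ((1 + `|u|) * (1 + `|v|)).
  by rewrite /Phi; field; apply/andP; split; rewrite gt_eqF //; lra.
have h1 : 0 <= v * `|u| - u * `|v|.
  have vu : u <= v by rewrite /v; lra.
  case: (ger0P u) => u0; case: (ger0P v) => v0; nra.
have -> : v - u = beta by rewrite /v; ring.
have D0 : 0 < (1 + `|u|) * (1 + `|v|) by rewrite mulr_gt0 //; lra.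
have -> : 4 / beta * ((beta + (v * `|u| - u * `|v|)) / ((1 + `|u|) * (1 + `|v|))) =
   4 / ((1 + `|u|) * (1 + `|v|)) + 4 / beta * (v * `|u| - u * `|v|) / ((1 + `|u|) * (1
     + `|v|)).
  by field; apply/and3P; split; rewrite gt_eqF //; lra.
apply: (@le_trans _ _ (4 / ((1 + `|u|) * (1 + `|v|)))); last first.
  rewrite lerDl; apply: divr_ge0; last exact: ltW.
  by apply: mulr_ge0 => //; apply: divr_ge0; [lra|exact: ltW].
rewrite -[leLHS]div1r ler_pdivrMr; last by have := sqr_ge0 u; lra.
rewrite mulrAC ler_pdivlMr // mul1r -(real_normK (num_real u)).
apply: (@le_trans _ _ ((1 + `|u|) * (2 + `|u|))).
  by rewrite ler_pM2l; lra.
by have := sqr_ge0 (`|u| - 1/2); nra.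
Qed.

(** The increments of [Phi] telescope to at most 2, whatever the centre [y] and the number of terms.
    This plays the role of the Gaussian integral. *)
Lemma grid_gaussian_sum (N : nat) beta y : 0 < beta <= 1 ->
  \sum_(k < N) expR (- (beta * k%:R - y) ^+ 2) <= 8 / beta.
Proof.
move=> b01; have /andP[b0 _] := b01.
pose F (k : nat) := Phi (beta * k%:R - y).
apply: (@le_trans _ _ (\sum_(k < N) 4 / beta * (F k.+1 - F k))).
  apply: ler_sum => k _; apply: le_trans (Phi_incr _ b01) _.
  rewrite /F -[in k.+1%:R]natr1.
  by have -> : beta * (k%:R + 1) - y = beta * k%:R - y + beta by ring.
rewrite -mulr_sumr -(big_mkord predT (fun k => F k.+1 - F k)) telescope_sumr //.
have -> : 8 / beta = 4 / beta * 2 by ring.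
apply: ler_wpM2l; first by rewrite divr_ge0 // ltW.
have : `|F N| <= 1 by exact: Phi_bound.
have : `|F 0| <= 1 by exact: Phi_bound.
rewrite !ler_norml => /andP[? ?] /andP[? ?]; lra.
Qed.

(** Bounds the chi-square divergence of a product law by those of its factors. With [s] the sum, the
    product is at most [expR s <= (1 - s)^-1 <= 1 + 2 s] for [0 <= s <= 1 / 2]. *)
Lemma prod1D_le (I : finType) (x : I -> R) :
  (forall i, 0 <= x i) -> \sum_i x i <= 1 / 2 ->
  \prod_i (1 + x i) - 1 <= 2 * \sum_i x i.
Proof.
move=> x0 s1.
suff h : \prod_i (1 + x i) <= 1 + 2 * \sum_i x i by lra.
have s0 : 0 <= \sum_i x i by exact: sumr_ge0.
apply: (@le_trans _ _ (expR (\sum_i x i))).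
  rewrite expR_sum; apply: ler_prod => i _; rewrite expR_ge1Dx andbT; have := x0 i; lra.
set s := \sum_i x i in s0 s1 *.
have := expR_ge1Dx (- s); rewrite expRN => e1.
have e0 := expR_gt0 s.
have : (1 - s) * expR s <= 1 by rewrite -ler_pdivlMr // div1r.
move=> h; rewrite -(@ler_pM2l _ (1 - s)); last lra.
by apply: le_trans h _; nra.
Qed.

End real_inequalities.

(** * Estimation on a grid from finitely many messages *)

(** Measured in nats, whence the factors [ln 2] next to budgets in bits. *)
Definition entropy {R : realType} (I : finType) (p : I -> R) : R :=
  \sum_y - (p y * ln (p y)).

Section entropy.
Context {R : realType} (I : finType) (p : I -> R).
Hypotheses (p0 : forall y, 0 <= p y) (p1 : \sum_y p y = 1).

Lemma entropy_ge0 : 0 <= entropy p.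
Proof.
apply: sumr_ge0 => y _; rewrite oppr_ge0 mulr_ge0_le0 // ln_le0 //.
by rewrite -p1 (bigD1 y) //= lerDl sumr_ge0.
Qed.

(** Gibbs' inequality against the counting weights. *)
Lemma entropy_le_ln_card : entropy p <= ln #|I|%:R.
Proof.
apply: le_trans (@gibbs _ _ p (fun=> 1) p0 (fun=> ltr01) _) _; rewrite ?p1 //.
rewrite ln1 /= big1 => [|y _]; last by rewrite mulr0 oppr0.
by rewrite subr0 mul1r add0r sumr_const.
Qed.

End entropy.

Section grid.
Context {R : realType} (d m N' : nat) (T_ : 'I_m -> finType).

Let N := N'.+2.
Let Z := {dffun forall i, T_ i}.

(** Addition in ['I_N] is modulo [N], so translation by the shift permutes the grid and leaves sums
    over it invariant. A wrap-around occurs exactly when coordinate [j] becomes 0. *)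
Definition grid_shift (j : 'I_d) : {ffun 'I_d -> 'I_N} :=
  [ffun l => if l == j then 1 else 0].

Context (P : forall i, {ffun 'I_d -> 'I_N} -> T_ i -> R).
Arguments P : clear implicits.
Hypotheses (P0 : forall i k y, 0 <= P i k y) (P1 : forall i k, \sum_y P i k y = 1).

Let G := {ffun 'I_d -> 'I_N}.
Let n : R := #|G|%:R.
Let Pj (k : G) (z : Z) := \prod_i P i k (z i).

Let n0 : 0 < n. Proof. by rewrite ltr0n; apply/card_gt0P; exists 0. Qed.

Let nE : n = N%:R ^+ d.
Proof. by rewrite /n card_ffun !card_ord natrX. Qed.

Let Pj0 k z : 0 <= Pj k z. Proof. exact: prodr_ge0. Qed.

Let Pj1 k : \sum_z Pj k z = 1.
Proof. by rewrite -(prod_sum_dffun (fun i => P i k)) big1. Qed.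

(** Entropy is additive over independent messages. Null transcripts are set aside because [ln]
    splits a product only when its factors are positive. *)
Let Pj_entropy k : \sum_z - (Pj k z * ln (Pj k z)) = \sum_i entropy (P i k).
Proof.
transitivity (\sum_z \sum_i Pj k z * - ln (P i k (z i))).
  apply: eq_bigr => z _; rewrite -mulr_sumr sumrN mulrN; congr (- _).
  have := Pj0 k z; rewrite le_eqVlt => /orP[/eqP <-|Pz]; first by rewrite !mul0r.
  congr (_ * _).
  have Pi i : 0 < P i k (z i).
    rewrite lt_def P0 andbT; apply: contraTneq Pz => Pi0.
    by rewrite /Pj (bigD1 i) //= Pi0 mul0r ltxx.
  rewrite /Pj; elim: (index_enum _) => [|i s IH]; first by rewrite !big_nil ln1.
  by rewrite !big_cons lnM ?posrE ?prodr_gt0 // IH.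
rewrite exchange_big /=; apply: eq_bigr => i _.
apply: etrans (@sum_dffun_marginal _ _ _ (fun i => P i k) (fun i y => - ln (P i k y)) i
  _) _ => //.
by apply: eq_bigr => y _; rewrite mulrN.
Qed.

Context (T : Z -> 'I_d -> R).

(** The number of grid points times the Bayes risk of [T] under the uniform prior on the points
    [k / N]. *)
Definition grid_error : R :=
  \sum_(k : G) \sum_z Pj k z * \sum_j (T z j - (k j)%:R / N%:R) ^+ 2.

(* Gibbs' inequality for the joint law of the parameter and the transcripts,
   against the weights [exp (- l^2 |T z - theta|^2)]. *)
Lemma sum_entropy_le (l : R) : 0 < l <= N%:R ->
  \sum_(k : G) \sum_i entropy (P i k) <=
  l ^+ 2 * grid_error + n * (\sum_i ln #|T_ i|%:R + d%:R * (ln 8 - ln l)).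
Proof.
move=> /andP[l0 lN].
have N0 : 0 < N%:R :> R by rewrite ltr0n.
pose p (x : G * Z) := Pj x.1 x.2.
pose q (x : G * Z) := expR (- (l ^+ 2 * \sum_j (T x.2 j - (x.1 j)%:R / N%:R) ^+ 2)).
have pn : \sum_x p x = n.
  rewrite -(pair_bigA _ (fun k z => Pj k z)) /= (eq_bigr (fun=> 1)) => [|k _];
    last exact: Pj1.
  by rewrite sumr_const.
have := @gibbs R (G * Z)%type p q (fun x => Pj0 _ _) (fun x => expR_gt0 _).
rewrite pn => /(_ n0).
rewrite -(pair_bigA _ (fun k z => - (Pj k z * ln (Pj k z)))) /=.
under eq_bigr do rewrite Pj_entropy.
move=> h; apply: (le_trans h); apply: lerD.
  rewrite /grid_error mulr_sumr -(pair_bigA _ (fun k z => - (Pj k z * ln (q (k, z)))))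
    /=.
  apply: eq_imp_le; apply: eq_bigr => k _.
  by rewrite mulr_sumr; apply: eq_bigr => z _; rewrite /q /= expRK; ring.
rewrite ler_pM2l //.
have T0 i : (0 < #|T_ i|)%N.
  rewrite lt0n; apply: contraPneq (P1 i 0) => /card0_eq e.
  by rewrite big_pred0 => [|y]; [apply/eqP; rewrite eq_sym oner_neq0|exact: e].
have S0 : 0 < \prod_i #|T_ i|%:R :> R by apply: prodr_gt0 => i _; rewrite ltr0n.
have l8 : 0 < 8 / (l / N%:R) by rewrite !divr_gt0.
(* For each transcript the sum of the weights over the grid factorizes into one Gaussian sum of step
   [l / N <= 1] per coordinate. Its factor [N ^+ d] then cancels [ln n]. *)
suff h1 : \sum_x q x <= (\prod_i #|T_ i|%:R) * (8 / (l / N%:R)) ^+ d.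
  have q0 : 0 < \sum_x q x.
    pose z0 : Z := [ffun i => enum_val (Ordinal (T0 i))].
    rewrite (bigD1 ((0 : G), z0)) //= ltr_wpDr ?expR_gt0 //.
    by apply: sumr_ge0 => x _; exact: expR_ge0.
  have := h1; rewrite -ler_ln ?posrE ?mulr_gt0 ?exprn_gt0 //.
  move=> /(fun h => lerB h (lexx (ln n))) h2.
  apply: (le_trans h2); rewrite lnM ?posrE ?exprn_gt0 // nE !lnXn // ln_div ?posrE
    ?divr_gt0 //.
  rewrite ln_div ?posrE // !mulr_natl -addrA lerD //; last first.
    by rewrite -mulrnBl; apply: eq_imp_le; congr (_ *+ _); ring.
  apply: eq_imp_le.
  elim: (index_enum _) => [|i s IH]; first by rewrite !big_nil ln1.
  rewrite !big_cons lnM ?posrE ?ltr0n ?IH //.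
  by apply: prodr_gt0 => ? _; rewrite ltr0n.
rewrite -(pair_bigA _ (fun k z => q (k, z))) exchange_big /=.
have -> : \prod_i #|T_ i|%:R = \sum_(z : Z) 1 :> R.
  transitivity (\prod_i \sum_(y : T_ i) 1 : R); first by apply: eq_bigr => i _;
    rewrite sumr_const.
  by rewrite prod_sum_dffun; apply: eq_bigr => z _; rewrite big1.
rewrite mulr_suml; apply: ler_sum => z _; rewrite mul1r.
apply: (@le_trans _ _
  (\sum_(k : G) \prod_j expR (- (l / N%:R * (k j)%:R - l * T z j) ^+ 2))).
  apply: eq_imp_le; apply: eq_bigr => k _.
  rewrite /q /= -expR_sum mulr_sumr -sumrN; congr expR; apply: eq_bigr => j _.
  by field; rewrite gt_eqF.
rewrite -(bigA_distr_bigA (fun j (k : 'I_N) =>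
  expR (- (l / N%:R * k%:R - l * T z j) ^+ 2))) /=.
rewrite -[X in _ ^+ X]card_ord -prodr_const; apply: ler_prod => j _.
rewrite sumr_ge0 => [|k _]; last exact: expR_ge0.
by apply: grid_gaussian_sum; rewrite divr_gt0 //= ler_pdivrMr // mul1r.
Qed.

(** Relative increment of the likelihood of a message when coordinate [j] moves by one step; [chi]
    below is the corresponding chi-square divergence, a discrete Fisher information. *)
Context (s : forall i, 'I_d -> {ffun 'I_d -> 'I_N} -> T_ i -> R).
Arguments s : clear implicits.
Hypothesis Ps : forall i j k y, (k + grid_shift j) j != 0 ->
  P i (k + grid_shift j) y = P i k y * (1 + s i j k y).
Hypothesis s1 : forall i j k, \sum_y P i k y * s i j k y = 0.

Let chi i j k := \sum_y P i k y * s i j k y ^+ 2.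

(** A parabolic weight that vanishes at both 0 and [N], so that summation by parts on the cyclic
    grid has no boundary term. *)
Let W (x : R) := x * (N%:R - x).

Let val_shift j k : nat_of_ord (((k : G) + grid_shift j) j) = ((k j).+1 %% N)%N.
Proof. by rewrite !ffunE eqxx /= modnDmr addn1. Qed.

Let W_shift j (k : G) : W ((k + grid_shift j)%R j)%:R = W ((k j)%:R + 1).
Proof.
rewrite val_shift natr1; have := ltn_ord (k j);
  rewrite -ltnS leq_eqVlt => /orP[/eqP[->]|h].
  by rewrite modnn /W subrr mulr0 mul0r.
by rewrite modn_small.
Qed.

Let W_bound x : W x ^+ 2 <= N%:R ^+ 4 / 16 \/ ~ (0 <= x <= N%:R).
Proof.
case: (boolP (0 <= x <= N%:R)) => [/andP[x0 xN]|]; [left|by move/negP; right].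
have -> : N%:R ^+ 4 / 16 = (N%:R ^+ 2 / 4) ^+ 2 :> R by field.
rewrite ler_sqr ?nnegrE ?divr_ge0 ?exprn_ge0 ?mulr_ge0 ?subr_ge0 //.
by rewrite /W; have := sqr_ge0 (N%:R - 2 * x); lra.
Qed.

(** The sum is exactly [N (N^2 - 1) / 6], and the bound is an equality at [N = 2]. *)
Let sumW : \sum_(k < N) W k%:R >= N%:R ^+ 3 / 8.
Proof.
have h (q : nat) : \sum_(k < q) W k%:R =
    (q%:R - 1) * q%:R * N%:R / 2 - (q%:R - 1) * q%:R * (2 * q%:R - 1) / 6.
  elim: q => [|q IH]; first by rewrite big_ord0; ring.
  by rewrite big_ord_recr /= IH -natr1 /W; field.
rewrite h.
have : 2 <= N%:R :> R by rewrite ler_nat.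
move: (N%:R : R) => x x2; have : 0 <= x * (x - 2) * (x + 2) by rewrite !mulr_ge0; lra.
lra.
Qed.

(** Averaging over the diagonal translations of the cyclic grid makes coordinate [j] uniform. *)
Let sum_coord (f : 'I_N -> R) j : N%:R * \sum_(k : G) f (k j) = n * \sum_a f a.
Proof.
have -> : N%:R * \sum_(k : G) f (k j) = \sum_(a : 'I_N) \sum_(k : G) f (k j).
  by rewrite sumr_const card_ord mulr_natl.
under eq_bigr => a _ do rewrite (reindex_inj (addIr [ffun l => a])).
rewrite exchange_big /=.
transitivity (\sum_(k : G) \sum_a f a); last by rewrite sumr_const mulr_natl.
apply: eq_bigr => k _; rewrite [RHS](reindex_inj (addrI (k j))).
by apply: eq_bigr => a _; rewrite !ffunE.
Qed.

(* A discrete van Trees inequality: [psi] is the discrete derivative of the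
   joint density weighted by [W], so that summation by parts gives the
   correlation of [psi] with the error, and Cauchy-Schwarz concludes. *)
Lemma grid_error_ge :
  (forall j k, \sum_i chi i j k <= 1 / 2) ->
  (d%:R * n * N%:R / 8) ^+ 2 <=
  (N%:R ^+ 4 / 8 * \sum_(k : G) \sum_j \sum_i chi i j k + d%:R * n * N%:R ^+ 2) *
  grid_error.
Proof.
move=> chi_le.
have N0 : N%:R != 0 :> R by rewrite pnatr_eq0.
pose F j (k : G) z := W (k j)%:R * Pj k z.
pose L j k z : R := \prod_i (1 + s i j k (z i)).
pose psi j (k : G) z := W ((k + grid_shift j)%R j)%:R * (L j k z - 1) +
   (W ((k + grid_shift j)%R j)%:R - W (k j)%:R).
(* At a wrap-around the weight of the shifted point is 0, so the identity holds there although [Ps]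
   says nothing. *)
have Ppsi j k z : Pj k z * psi j k z = F j (k + grid_shift j) z - F j k z.
  have [k0|k0] := eqVneq ((k + grid_shift j) j) 0.
    by rewrite /F /psi k0 /W !mul0r; ring.
  have PL : Pj (k + grid_shift j) z = Pj k z * L j k z.
    by rewrite /Pj /L -big_split; apply: eq_bigr => i _; rewrite Ps.
  by rewrite /F PL /psi; ring.
have corr j : \sum_(k : G) \sum_z Pj k z * (psi j k z * (T z j - (k j)%:R / N%:R)) =
    N%:R^-1 * \sum_(k : G) W (k j)%:R.
  transitivity (\sum_z N%:R^-1 * \sum_(k : G) F j k z); last first.
    rewrite -mulr_sumr exchange_big; congr (_ * _); apply: eq_bigr => k _.
    by rewrite -mulr_sumr Pj1 mulr1.
  rewrite exchange_big; apply: eq_bigr => z _ /=.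
  have shiftF (f : G -> R) : \sum_(k : G) f (k + grid_shift j) = \sum_(k : G) f k.
    by rewrite [RHS](reindex_inj (addIr (grid_shift j))).
  transitivity (T z j * (\sum_(k : G) F j (k + grid_shift j) z - \sum_(k : G) F j k z) -
      \sum_(k : G) (k j)%:R / N%:R * F j (k + grid_shift j) z +
      \sum_(k : G) (k j)%:R / N%:R * F j k z).
    rewrite -sumrB mulr_sumr -sumrB -big_split; apply: eq_bigr => k _ /=.
    by rewrite mulrA Ppsi; ring.
  (* The estimator drops out, as the differences of [F] sum to zero. What remains is the increment
     [1 / N] of the parameter, weighted by [F]. *)
  rewrite (shiftF (F j ^~ z)) subrr mulr0 add0r.
  rewrite -(shiftF (fun k => (k j)%:R / N%:R * F j k z)) -(shiftF (F j ^~ z)).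
  rewrite mulr_sumr addrC -sumrB; apply: eq_bigr => k _.
  have [k0|k0] := eqVneq ((k + grid_shift j) j) 0.
    by rewrite /F k0 /W !mul0r !mulr0 subrr.
  suff -> : ((k + grid_shift j)%R j)%:R = (k j)%:R + 1 :> R by field.
  move: k0; rewrite -val_eqE /= !val_shift.
  have := ltn_ord (k j); rewrite -ltnS leq_eqVlt => /orP[/eqP[->]|h _].
    by rewrite modnn.
  by rewrite modn_small // natr1.
have psi2 j k : \sum_z Pj k z * psi j k z ^+ 2 <=
    N%:R ^+ 4 / 8 * \sum_i chi i j k + N%:R ^+ 2.
  set w := W ((k + grid_shift j)%R j)%:R; set w' := W (k j)%:R.
  have L1 : \sum_z Pj k z * L j k z = 1.
    under eq_bigr do rewrite /Pj /L -big_split /=.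
    rewrite -(prod_sum_dffun (fun i y => P i k y * (1 + s i j k y))) big1 // => i _.
    by under eq_bigr do rewrite mulrDr mulr1; rewrite big_split /= P1 s1 addr0.
  have L2 : \sum_z Pj k z * L j k z ^+ 2 = \prod_i (1 + chi i j k).
    transitivity (\sum_(z : Z) \prod_i (P i k (z i) * (1 + s i j k (z i)) ^+ 2)).
      by apply: eq_bigr => z _; rewrite /L -prodrXl -big_split.
    rewrite -(prod_sum_dffun (fun i y => P i k y * (1 + s i j k y) ^+ 2));
      apply: eq_bigr => i _.
    transitivity
        (\sum_y (P i k y + 2 * (P i k y * s i j k y) + P i k y * s i j k y ^+ 2)).
      by apply: eq_bigr => y _; ring.
    by rewrite !big_split /= -mulr_sumr P1 s1 mulr0 addr0.
  (* [L] has mean 1 under [Pj k], so the cross term between the likelihood increment and the weight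
     increment vanishes. *)
  have -> : \sum_z Pj k z * psi j k z ^+ 2 =
      w ^+ 2 * (\prod_i (1 + chi i j k) - 1) + (w - w') ^+ 2.
    transitivity (\sum_z (w ^+ 2 * (Pj k z * L j k z ^+ 2) -
        2 * w * w' * (Pj k z * L j k z) + w' ^+ 2 * Pj k z)).
      by apply: eq_bigr => z _; rewrite /psi -/w -/w'; ring.
    by rewrite !big_split /= sumrN -!mulr_sumr L1 L2 Pj1; ring.
  have chi0 i : 0 <= chi i j k by apply: sumr_ge0 => y _; rewrite mulr_ge0 ?sqr_ge0.
  have kN : (k j)%:R + 1 <= N%:R :> R by rewrite natr1 ler_nat.
  have k0 : 0 <= (k j)%:R :> R by [].
  apply: lerD.
    apply: (@le_trans _ _ (N%:R ^+ 4 / 16 * (2 * \sum_i chi i j k))).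
      apply: ler_pM; [exact: sqr_ge0| | |exact: prod1D_le].
        rewrite subr_ge0; apply: (big_ind (fun x => 1 <= x)) => // [x y|i _];
          first exact: mulr_ege1.
        by rewrite lerDl.
      by rewrite /w W_shift; case: (@W_bound ((k j)%:R + 1)) => [//|[]]; apply/andP;
        split; lra.
    by apply: eq_imp_le; field.
  (* The increment of [W] is [N - 2 k - 1], at most [N] in absolute value. *)
  rewrite /w W_shift /w' /W.
  have -> : ((k j)%:R + 1) * (N%:R - ((k j)%:R + 1)) - (k j)%:R * (N%:R - (k j)%:R) =
    N%:R - 2 * (k j)%:R - 1 :> R by ring.
  rewrite -subr_ge0 subr_sqr mulr_ge0 //; lra.
pose p (x : 'I_d * (G * Z)) := Pj x.2.1 x.2.2.
pose f (x : 'I_d * (G * Z)) := psi x.1 x.2.1 x.2.2.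
pose g (x : 'I_d * (G * Z)) := T x.2.2 x.1 - (x.2.1 x.1)%:R / N%:R.
have tri (h : 'I_d -> G -> Z -> R) : \sum_x h x.1 x.2.1 x.2.2 = \sum_j \sum_(k : G)
  \sum_z h j k z.
  rewrite -(pair_bigA _ (fun j (y : G * Z) => h j y.1 y.2)); apply: eq_bigr => j _ /=.
  by rewrite -(pair_bigA _ (fun k z => h j k z)).
have := @sum_CauchySchwarz R ('I_d * (G * Z))%type p f g (fun x => Pj0 _ _).
rewrite (tri (fun j k z => Pj k z * (psi j k z * (T z j - (k j)%:R / N%:R)))).
rewrite (tri (fun j k z => Pj k z * psi j k z ^+ 2)).
rewrite (tri (fun j k z => Pj k z * (T z j - (k j)%:R / N%:R) ^+ 2)).
have -> : \sum_j \sum_(k : G) \sum_z Pj k z * (T z j - (k j)%:R / N%:R) ^+ 2 =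
  grid_error.
  rewrite exchange_big; apply: eq_bigr => k _; rewrite exchange_big;
    apply: eq_bigr => z _.
  by rewrite mulr_sumr.
move=> CS; apply: le_trans (le_trans CS _); last first.
  apply: ler_wpM2r.
    by apply: sumr_ge0 => k _; apply: sumr_ge0 => z _;
      rewrite mulr_ge0 // sumr_ge0 // => j _; rewrite sqr_ge0.
  apply: (@le_trans _ _
    (\sum_j \sum_(k : G) (N%:R ^+ 4 / 8 * (\sum_i chi i j k) + N%:R ^+ 2))).
    by apply: ler_sum => j _; apply: ler_sum => k _; exact: psi2.
  rewrite exchange_big mulr_sumr; apply: eq_imp_le.
  under eq_bigr do rewrite big_split /= -mulr_sumr.
  by rewrite big_split /= !sumr_const card_ord -mulrnA -[in RHS]mulrA !mulr_natl
    mulrnAC mulrnA.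
rewrite ler_sqr ?nnegrE; last 2 first.
- by rewrite !mulr_ge0 // ltW.
- apply: sumr_ge0 => j _; rewrite corr mulr_ge0 // sumr_ge0 // => k _.
  by rewrite mulr_ge0 // subr_ge0 ler_nat ltnW.
under eq_bigr do rewrite corr.
apply: (@le_trans _ _ (\sum_(j < d) (n * N%:R / 8))).
  by rewrite sumr_const card_ord -mulr_natl; apply: eq_imp_le; ring.
apply: ler_sum => j _.
have N0' : 0 < N%:R :> R by rewrite ltr0n.
rewrite [leRHS]mulrC ler_pdivlMr // -(ler_pM2l N0') (sum_coord (fun a => W a%:R)).
have -> : N%:R * (n * N%:R / 8 * N%:R) = n * (N%:R ^+ 3 / 8) by field.
by rewrite ler_pM2l.
Qed.

End grid.

(** * Information bounds inserted into the two grid inequalities *)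

Section grid_experiment.
Context {R : realType} (d m : nat) (b : 'I_m -> nat) (sigma : R) (N' : nat).
Hypotheses (s0 : 0 < sigma) (d0 : (0 < d)%N) (m0 : (0 < m)%N).
Hypothesis b0 : forall i, (0 < b i)%N.

Let N := N'.+2.
(** The grid step in units of the standard deviation. *)
Let t : R := N%:R^-1 / sigma.

(* [K] will be [2048 * expR 8]; keeping it abstract spares unification the unary
   numeral. *)
Context (K : R).
Hypotheses (K34 : 34 <= K) (tN : d%:R * m%:R * K * t ^+ 2 <= 1).

(* [P' i j k] is the law of message [i] when coordinate [j] of the grid point
   [k] is increased by one step, without the wrap-around of [grid_shift]. *)
Context (P : forall i, {ffun 'I_d -> 'I_N} -> (b i).-tuple bool -> R).
Context (P' : forall i, 'I_d -> {ffun 'I_d -> 'I_N} -> (b i).-tuple bool -> R).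
Arguments P : clear implicits.
Arguments P' : clear implicits.
Hypotheses (P0 : forall i k y, 0 <= P i k y) (P1 : forall i k, \sum_y P i k y = 1).
Hypothesis P'1 : forall i j k, \sum_y P' i j k y = 1.
Hypothesis PP' : forall i j (k : {ffun 'I_d -> 'I_N}) y,
  (k + grid_shift N' j) j != 0 -> P i (k + grid_shift N' j) y = P' i j k y.
Hypothesis P'_ac : forall i j k y,
  P' i j k y = P i k y * (1 + (P' i j k y / P i k y - 1)).
Hypothesis P'_chi : forall i j k,
  \sum_y P i k y * (P' i j k y / P i k y - 1) ^+ 2 <= 16 * t ^+ 2 + K * t ^+ 4.
Hypothesis sum_P'_chi : forall i k,
  \sum_j \sum_y P i k y * (P' i j k y / P i k y - 1) ^+ 2 <=
  4 * t ^+ 2 * entropy (P i k) + d%:R * (K * t ^+ 4).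

Let ratio i j (k : {ffun 'I_d -> 'I_N}) (y : (b i).-tuple bool) : R :=
  if (k + grid_shift N' j) j == 0 then 0 else P' i j k y / P i k y - 1.

Let dR : 1 <= d%:R :> R. Proof. by rewrite ler1n. Qed.
Let mR : 1 <= m%:R :> R. Proof. by rewrite ler1n. Qed.

Let t0 : 0 <= t. Proof. by rewrite divr_ge0 ?invr_ge0 // ltW. Qed.

Let t01 : 0 <= t <= 1.
Proof.
rewrite t0 /= -(@expr_le1 _ 2) //; apply: le_trans tN.
rewrite ler_peMl ?sqr_ge0 //.
by apply: mulr_ege1; [exact: mulr_ege1|move: K34; lra].
Qed.

Let tm : K * t ^+ 2 <= (m%:R)^-1.
Proof.
rewrite -[leRHS]div1r ler_pdivlMr ?ltr0n //.
apply: le_trans tN; rewrite [leRHS](_ : _ = d%:R * (K * t ^+ 2 * m%:R)); last by ring.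
rewrite ler_peMl //; apply: mulr_ge0 => //; apply: mulr_ge0; last exact: sqr_ge0.
by move: K34; lra.
Qed.

(** The grid is so fine that the remainders of order [t ^+ 4], summed over coordinates and machines,
    cost at most one [t ^+ 2]. *)
Let tdm : d%:R * (K * t ^+ 4) <= t ^+ 2 * (m%:R)^-1.
Proof.
have -> : d%:R * (K * t ^+ 4) = t ^+ 2 * (d%:R * (K * t ^+ 2)) by ring.
apply: ler_wpM2l; first exact: sqr_ge0.
rewrite -[leRHS]div1r ler_pdivlMr ?ltr0n //.
by apply: le_trans tN; apply: eq_imp_le; ring.
Qed.

Let P_shift i j (k : {ffun 'I_d -> 'I_N}) y : (k + grid_shift N' j) j != 0 ->
  P i (k + grid_shift N' j) y = P i k y * (1 + @ratio i j k y).
Proof. by move=> k0; rewrite PP' // /ratio (negbTE k0) -P'_ac. Qed.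

Let ratio_mean i j k : \sum_y P i k y * @ratio i j k y = 0.
Proof.
rewrite /ratio; case: eqP => _; first by rewrite big1 // => y _; rewrite mulr0.
transitivity (\sum_y (P' i j k y - P i k y)); last by rewrite sumrB P'1 P1 subrr.
by apply: eq_bigr => y _; rewrite [in RHS]P'_ac; ring.
Qed.

Let chi i j k : R := \sum_y P i k y * @ratio i j k y ^+ 2.

Let chi_le i j k : chi i j k <= 17 * t ^+ 2.
Proof.
rewrite /chi /ratio; case: eqP => _.
  by rewrite big1 => [|y _]; [rewrite mulr_ge0 // sqr_ge0|rewrite expr0n mulr0].
apply: le_trans (P'_chi i j k) _.
have : K * t ^+ 4 <= t ^+ 2; last by lra.
have -> : K * t ^+ 4 = t ^+ 2 * (K * t ^+ 2) by ring.
rewrite ler_piMr ?sqr_ge0 //; apply: le_trans tm _.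
by rewrite invf_le1 ?ltr0n.
Qed.

(** Up to the squared step, the Fisher information of message [i] is at most four times its entropy
    over [sigma ^+ 2]. The terms [1 / m] will sum to 1 over the machines. *)
Let sum_chi_le i k : \sum_j chi i j k <= t ^+ 2 * (4 * entropy (P i k) + (m%:R)^-1).
Proof.
apply: (@le_trans _ _ (4 * t ^+ 2 * entropy (P i k) + d%:R * (K * t ^+ 4))); last first.
  by rewrite mulrDr; apply: lerD => //; apply: eq_imp_le; ring.
apply: le_trans (sum_P'_chi i k).
apply: ler_sum => j _; rewrite /chi /ratio; case: eqP => // _.
rewrite big1 => [|y _]; last by rewrite expr0n mulr0.
by apply: sumr_ge0 => y _; rewrite mulr_ge0 ?sqr_ge0 ?P0.
Qed.

Context (T : transcript b -> 'I_d -> R).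

Let n : R := #|{ffun 'I_d -> 'I_N}|%:R.
Let V := grid_error P T.

Let total_entropy : R := \sum_k \sum_i entropy (P i k).

Let n0 : 0 < n. Proof. by rewrite ltr0n; apply/card_gt0P; exists 0. Qed.

Lemma total_entropy_ge0 : 0 <= total_entropy.
Proof. by apply: sumr_ge0 => k _; apply: sumr_ge0 => i _; exact: entropy_ge0. Qed.

Lemma total_entropy_le l : 0 < l <= N%:R ->
  total_entropy <= l ^+ 2 * V + n * ((\sum_i b i)%N%:R * ln 2 + d%:R * (ln 8 - ln l)).
Proof.
move=> lN; apply: le_trans (@sum_entropy_le _ _ _ _ _ _ P0 P1 T l lN) _.
have -> // : \sum_i ln #|{: (b i).-tuple bool}|%:R = (\sum_i b i)%N%:R * ln 2 :> R.
rewrite natr_sum mulr_suml; apply: eq_bigr => i _.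
by rewrite card_tuple card_bool natrX lnXn // mulr_natl.
Qed.

(** Since [t * N = 1 / sigma], division by [N ^+ 2] turns the van Trees bound into one free of the
    grid step. *)
Let error_ge (Y : R) : \sum_k \sum_i \sum_j chi i j k <= t ^+ 2 * Y ->
  d%:R ^+ 2 * n ^+ 2 / 64 <= (Y / (8 * sigma ^+ 2) + d%:R * n) * V.
Proof.
move=> chiY.
have N0 : 0 < N%:R :> R by rewrite ltr0n.
have V0 : 0 <= V.
  apply: sumr_ge0 => k _; apply: sumr_ge0 => z _.
  by rewrite mulr_ge0 ?prodr_ge0 // sumr_ge0 // => j _; rewrite sqr_ge0.
(* [17 * t ^+ 2 * m <= 1 / 2] is what [34 <= K] provides. *)
have chi2 j k : \sum_i chi i j k <= 1 / 2.
  apply: (@le_trans _ _ (\sum_(i < m) 17 * t ^+ 2)); first by apply: ler_sum => i _;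
    exact: chi_le.
  rewrite sumr_const card_ord -mulr_natr.
  have : 34 * t ^+ 2 * m%:R <= 1; last by lra.
  apply: (@le_trans _ _ (K * t ^+ 2 * m%:R)).
    by rewrite ler_wpM2r // ler_wpM2r ?sqr_ge0.
  by rewrite -ler_pdivlMr ?div1r // ltr0n.
have := grid_error_ge P0 P1 T P_shift ratio_mean chi2.
rewrite -/V -/n.
have -> : \sum_k \sum_j \sum_i chi i j k = \sum_k \sum_i \sum_j chi i j k.
  by apply: eq_bigr => k _; rewrite exchange_big.
move=> h.
rewrite -(@ler_pM2l _ (N%:R ^+ 2)) ?exprn_gt0 //.
have -> : N%:R ^+ 2 * (d%:R ^+ 2 * n ^+ 2 / 64) = (d%:R * n * N%:R / 8) ^+ 2 by field.
apply: le_trans h _; rewrite [leRHS]mulrA; apply: ler_wpM2r => //.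
have -> : N%:R ^+ 2 * (Y / (8 * sigma ^+ 2) + d%:R * n) = N%:R ^+ 4 / 8 * (t ^+ 2 * Y)
  + d%:R * n * N%:R ^+ 2.
  by rewrite /t; field; rewrite !gt_eqF.
by rewrite lerD2r ler_wpM2l // divr_ge0 // exprn_ge0 // ltW.
Qed.

Lemma error_ge_entropy :
  d%:R ^+ 2 * n ^+ 2 / 64 <=
  ((4 * total_entropy + n) / (8 * sigma ^+ 2) + d%:R * n) * V.
Proof.
apply: error_ge.
have -> : t ^+ 2 * (4 * total_entropy + n) =
    \sum_(k : {ffun 'I_d -> 'I_N}) \sum_i t ^+ 2 * (4 * entropy (P i k) + (m%:R)^-1).
  transitivity
      (\sum_(k : {ffun 'I_d -> 'I_N}) t ^+ 2 * (4 * (\sum_i entropy (P i k)) + 1)).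
    by rewrite -mulr_sumr big_split /= -mulr_sumr sumr_const.
  apply: eq_bigr => k _; rewrite -mulr_sumr big_split /= -mulr_sumr sumr_const card_ord.
  by rewrite -[(m%:R)^-1 *+ m]mulr_natr mulVf // pnatr_eq0 -lt0n.
by apply: ler_sum => k _; apply: ler_sum => i _; exact: sum_chi_le.
Qed.

(** If [b i <= d], the entropy is at most [b i] and [4 b_i + 1 / m <= 17 b_i]; otherwise each of the
    [d] coordinates contributes at most [17 * t ^+ 2]. *)
Lemma error_ge_budget :
  d%:R ^+ 2 * n ^+ 2 / 64 <=
  (17 * n * (\sum_i minn (b i) d)%N%:R / (8 * sigma ^+ 2) + d%:R * n) * V.
Proof.
apply: error_ge.
have -> : t ^+ 2 * (17 * n * (\sum_i minn (b i) d)%N%:R) =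
    \sum_(k : {ffun 'I_d -> 'I_N}) \sum_i 17 * t ^+ 2 * (minn (b i) d)%:R.
  by rewrite sumr_const -mulr_sumr -natr_sum -[RHS]mulr_natr /n; ring.
apply: ler_sum => k _; apply: ler_sum => i _.
case: (leqP (b i) d) => bd; last first.
  rewrite -[X in _ * X%:R]card_ord mulr_natr -sumr_const; apply: ler_sum => j _;
    exact: chi_le.
apply: le_trans (sum_chi_le i k) _.
rewrite [leRHS](_ : _ = t ^+ 2 * (17 * (b i)%:R)); last by ring.
rewrite ler_wpM2l ?sqr_ge0 //.
have : entropy (P i k) <= (b i)%:R.
  apply: le_trans (entropy_le_ln_card (@P0 i k) (P1 i k)) _.
  rewrite card_tuple card_bool natrX lnXn // -[leLHS]mulr_natl ler_piMr //.
  by apply: le_trans (ln_le_subr1 _) _ => //; lra.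
have : 1 <= (b i)%:R :> R by rewrite ler1n.
have : (m%:R)^-1 <= 1 :> R by rewrite invf_le1 ?ltr0n.
lra.
Qed.

End grid_experiment.

(** * The three regimes *)

Section three_regimes.
(** Real arithmetic only: [D], [s], [B], [M] stand for [d], [sigma], the sum of the [b i] and the
    sum of the [minn (b i) d]; [n] is the size of the grid, and [V], [H] are [n] times the Bayes
    risk and the conditional entropy. *)
Context {R : realType} (D n V H s B M : R).
Hypotheses (D1 : 1 <= D) (n0 : 0 < n) (s0 : 0 < s) (H0 : 0 <= H).

Let ln2_gt0 : 0 < ln 2 :> R. Proof. by rewrite ln_gt0 // ltr1n. Qed.
Let ln2_le1 : ln 2 <= 1 :> R.
Proof. by apply: le_trans (ln_le_subr1 _) _ => //; lra. Qed.
Let ln8 : ln 8 = 3 * ln 2 :> R.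
Proof. by rewrite -(_ : 2 ^+ 3 = 8) ?lnXn // ?mulr_natl //; ring. Qed.

(** [expR 2] comes from the [+ 1] in the exponent of [l] below, and [200 = 64 * 25 / 8] from the
    budget regime. *)
Let c : R := (200 * expR 2)^-1.

Let c_le : c <= (200)^-1.
Proof.
have := expR_ge1Dx (2 : R) => e; rewrite lef_pV2 ?posrE ?mulr_gt0 ?expR_gt0 //; lra.
Qed.

(** This [l] makes [B * ln 2 + D * (ln 8 - ln l)] equal to [- D], and [0 <= H] leaves
    [n * D <= l ^+ 2 * V]. *)
Lemma coding_regime :
  let l := expR (B / D * ln 2 + ln 8 + 1) in
  H <= l ^+ 2 * V + n * (B * ln 2 + D * (ln 8 - ln l)) ->
  n * (c * 2 `^ (- 2 * (B / D)) * D) <= V.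
Proof.
move=> l; rewrite /l expRK; set r := B / D => h.
have D1' := D1; have H0' := H0; have n0' := n0; have c_le' := c_le.
have ln2_gt0' := ln2_gt0; have ln2_le1' := ln2_le1.
have D0 : 0 < D by lra.
have BD : B = r * D by rewrite /r divfK // gt_eqF.
have {}h : n * D <= l ^+ 2 * V.
  have : n * (B * ln 2 + D * (ln 8 - (r * ln 2 + ln 8 + 1))) = - (n * D) by rewrite BD;
    ring.
  move=> e; move: h; rewrite e -/l; lra.
have l0 : 0 < l ^+ 2 by rewrite exprn_gt0 // expR_gt0.
rewrite -(ler_pM2l l0); apply: le_trans h.
have -> : l ^+ 2 = 64 * expR 2 * (2 `^ (- 2 * r))^-1.
  rewrite /powR ifF; last by apply/negbTE.
  rewrite -expRN expr2 -expRD.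
  have -> : 64 = expR (2 * ln 8) :> R by rewrite expRM_natl lnK ?posrE //; ring.
  by rewrite -!expRD -/r; congr expR; ring.
have p0 : 0 < 2 `^ (- 2 * r) by rewrite powR_gt0.
have -> : 64 * expR 2 / 2 `^ (- 2 * r) * (n * (c * 2 `^ (- 2 * r) * D)) =
    64 / 200 * (n * D).
  by rewrite /c; field; rewrite !gt_eqF // expR_gt0.
have : 0 <= n * D by rewrite mulr_ge0 // ltW.
lra.
Qed.

(** Either [V >= n * D * s ^+ 2], which suffices because [x = r - L >= 2], or the coding inequality
    at [l = 1 / s] gives [H <= 3 * (n * D) * x], which bounds the information in the van Trees
    inequality. The final constant is [64 * 21 / 8 = 168 <= 200]. *)
Lemma localized_regime :
  let L := log2 (1 / s) in
  L + 2 <= B / D -> s <= 1 ->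
  H <= (1 / s) ^+ 2 * V + n * (B * ln 2 + D * (ln 8 - ln (1 / s))) ->
  D ^+ 2 * n ^+ 2 / 64 <= ((4 * H + n) / (8 * s ^+ 2) + D * n) * V ->
  n * (c * (D * s ^+ 2 / (B / D - L))) <= V.
Proof.
move=> L; set r := B / D => Lr s1 h1 h2.
have D1' := D1; have H0' := H0; have n0' := n0; have s0' := s0; have c_le' := c_le.
have ln2_gt0' := ln2_gt0; have ln2_le1' := ln2_le1.
have D0 : 0 < D by lra.
have BD : B = r * D by rewrite /r divfK // gt_eqF.
have LE : ln (1 / s) = L * ln 2 by rewrite /L /log2 divfK // gt_eqF.
set x := r - L; have x2 : 2 <= x by rewrite /x; lra.
have s20 : 0 < s ^+ 2 by rewrite exprn_gt0.
have s21 : s ^+ 2 <= 1 by rewrite expr_le1 // ltW.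
have nD0 : 0 < n * D by rewrite mulr_gt0.
have Q0 : 0 < n * (D * s ^+ 2 / x) by rewrite mulr_gt0 // divr_gt0 ?mulr_gt0 //; lra.
suff : n * (D * s ^+ 2 / x) <= 200 * V.
  have : n * (c * (D * s ^+ 2 / x)) <= n * (D * s ^+ 2 / x) / 200; last by lra.
  by rewrite mulrCA mulrC ler_pM2l.
have [Vs|Vs] := lerP (n * D * s ^+ 2) V.
  have : n * (D * s ^+ 2 / x) <= n * D * s ^+ 2; last by lra.
  have -> : n * (D * s ^+ 2 / x) = n * D * s ^+ 2 / x by ring.
  rewrite ler_pdivrMr; last lra.
  by rewrite ler_peMr ?mulr_ge0 // ?ltW //; lra.
(* A negative [V] would contradict the positive left side of the van Trees bound. *)
have V0 : 0 <= V.
  rewrite leNgt; apply/negP => V0.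
  have : ((4 * H + n) / (8 * s ^+ 2) + D * n) * V <= 0.
    rewrite mulr_ge0_le0 //; last exact: ltW.
    apply: addr_ge0; last by rewrite mulr_ge0 // ltW.
    apply: divr_ge0; first by lra.
    by rewrite mulr_ge0 // ltW.
  have : 0 < D ^+ 2 * n ^+ 2 / 64 by rewrite divr_gt0 // mulr_gt0 ?exprn_gt0.
  lra.
have HD : H <= 3 * (n * D) * x.
  have e1 : (1 / s) ^+ 2 * V <= n * D.
    by rewrite expr_div_n expr1n mul1r mulrC ler_pdivrMr // ltW.
  have e2 : n * (B * ln 2 + D * (ln 8 - ln (1 / s))) = n * D * (x * ln 2 + 3 * ln 2).
    by rewrite LE BD ln8 /x; ring.
  have e3 : n * D * (x * ln 2 + 3 * ln 2) <= n * D * (x + 3).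
    by rewrite ler_pM2l // lerD // ?ler_piMr //; lra.
  have e4 : n * D * 4 <= n * D * (2 * x) by rewrite ler_pM2l //; lra.
  by move: h1; rewrite e2; lra.
have K : (4 * H + n) / (8 * s ^+ 2) + D * n <= 21 / 8 * (n * D * x / s ^+ 2).
  have -> : 21 / 8 * (n * D * x / s ^+ 2) =
      (13 * (n * D * x)) / (8 * s ^+ 2) + n * D * x / s ^+ 2.
    by field; rewrite gt_eqF.
  have nx : n * D <= n * D * x by rewrite ler_peMr ?ltW //; lra.
  have nn : n <= n * D by rewrite ler_peMr // ltW.
  apply: lerD; first by rewrite ler_pM2r ?invr_gt0 ?mulr_gt0 //; lra.
  rewrite ler_pdivlMr // [D * n]mulrC.
  by apply: le_trans nx; rewrite ler_piMr // ltW.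
have h3 : D ^+ 2 * n ^+ 2 / 64 <= 21 / 8 * (n * D * x / s ^+ 2) * V.
  by apply: le_trans h2 _; rewrite ler_wpM2r.
have y0 : 0 < n * D * x / s ^+ 2 by rewrite divr_gt0 ?mulr_gt0 //; lra.
rewrite -(ler_pM2l y0).
have -> : n * D * x / s ^+ 2 * (n * (D * s ^+ 2 / x)) = D ^+ 2 * n ^+ 2.
  by field; rewrite !gt_eqF //; lra.
have : 0 <= n * D * x / s ^+ 2 * V by rewrite mulr_ge0 // ltW.
lra.
Qed.

(** The minimum [w] satisfies both [w * M <= D * s ^+ 2] and [w <= 1], one for each term of the
    information, so the product [A * w] is at most [(17 / 8 + 1) * (n * D)]. *)
Lemma budget_regime :
  0 < M ->
  D ^+ 2 * n ^+ 2 / 64 <= (17 * n * M / (8 * s ^+ 2) + D * n) * V ->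
  n * (c * (D * Num.min (s ^+ 2 / (M / D)) 1)) <= V.
Proof.
move=> M0 h.
have D1' := D1; have n0' := n0; have s0' := s0; have c_le' := c_le.
have D0 : 0 < D by lra.
have s20 : 0 < s ^+ 2 by rewrite exprn_gt0.
have nD0 : 0 < n * D by rewrite mulr_gt0.
set w := Num.min _ _.
have w1 : w <= 1 by rewrite ge_min lexx orbT.
have wM : w * M <= D * s ^+ 2.
  rewrite -ler_pdivlMr //; apply: (@le_trans _ _ (s ^+ 2 / (M / D)));
    first by rewrite ge_min lexx.
  by apply: eq_imp_le; field; rewrite !gt_eqF.
have w0 : 0 < w by rewrite lt_min ltr01 andbT !divr_gt0.
set A := 17 * n * M / (8 * s ^+ 2) + D * n in h.
have A0 : 0 < A by rewrite addr_gt0 // ?divr_gt0 ?mulr_gt0.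
have Aw : A * w <= 25 / 8 * (n * D).
  have -> : A * w = 17 / 8 * n * (w * M / s ^+ 2) + n * D * w.
    by rewrite /A; field; rewrite gt_eqF.
  have h1 : w * M / s ^+ 2 <= D by rewrite ler_pdivrMr.
  have h2 : n * (w * M / s ^+ 2) <= n * D by rewrite ler_pM2l.
  have h3 : n * D * w <= n * D by rewrite ler_piMr // ltW.
  lra.
have : n * D * w <= 200 * V.
  rewrite -(ler_pM2l A0).
  apply: (@le_trans _ _ (25 / 8 * (n * D) * (n * D))).
    by rewrite [leLHS](_ : _ = A * w * (n * D)) ?ler_pM2r //; ring.
  have -> : 25 / 8 * (n * D) * (n * D) = 200 * (D ^+ 2 * n ^+ 2 / 64) by field.
  by rewrite [leRHS](_ : _ = 200 * (A * V)) ?ler_pM2l //; ring.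
have : n * (c * (D * w)) <= n * D * w / 200; last by lra.
rewrite [leLHS](_ : _ = n * D * w * c); last by ring.
by rewrite ler_pM2l // mulr_gt0.
Qed.

End three_regimes.

Local Open Scope classical_set_scope.
Local Open Scope ring_scope.

(** * Gaussian densities *)

Section density.
Local Open Scope ereal_scope.
Context d (T : measurableType d) (R : realType).

(** From sets to nonnegative functions, by simple functions and monotone convergence. *)
Lemma ge0_integral_density (mu nu : {measure set T -> \bar R}) (rho : T -> R)
    (f : T -> \bar R) :
  measurable_fun setT rho -> (forall x, (0 <= rho x)%R) ->
  (forall A, measurable A -> nu A = \int[mu]_(x in A) (rho x)%:E) ->
  measurable_fun setT f -> (forall x, 0 <= f x) ->
  \int[nu]_x f x = \int[mu]_x (f x * (rho x)%:E).
Proof.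
move=> /measurable_EFinP mrho rho0 nuE mf f0.
pose h := nnsfun_approx measurableT mf.
have hf x : EFin \o h ^~ x @ \oo --> f x by exact: cvg_nnsfun_approx.
have mh n : measurable_fun setT (EFin \o h n) by exact/measurable_EFinP.
have h0 n x : 0 <= (h n x)%:E by rewrite lee_fin.
have ndh x a b : (a <= b)%N -> (h a x)%:E <= (h b x)%:E.
  by move=> ab; rewrite lee_fin; exact/lefP/nd_nnsfun_approx.
have rho0' x : 0 <= (rho x)%:E by rewrite lee_fin.
transitivity (limn (fun n => \int[nu]_x (h n x)%:E)).
  rewrite -monotone_convergence //; last by move=> x _ a b; exact: ndh.
  by apply: eq_integral => x _; apply/esym/cvg_lim => //; exact: hf.
transitivity (limn (fun n => \int[mu]_x ((h n x)%:E * (rho x)%:E))); last first.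
  rewrite -monotone_convergence //.
  - by apply: eq_integral => x _; apply/cvg_lim => //; apply: cvgeZr; last exact: hf.
  - by move=> n; apply: emeasurable_funM (mh n) mrho.
  - by move=> n x _; rewrite mule_ge0.
  - by move=> x _ a b ab; rewrite lee_wpmul2r // ndh.
congr (limn _); apply/funext => n.
under eq_integral do rewrite fimfunE -fsumEFin//.
have m1 r : measurable_fun setT (fun x => (r * \1_(h n @^-1` [set r]) x)%:E).
  by apply/measurable_EFinP; exact: measurable_funM.
rewrite ge0_integral_fsum//; last by move=> r x _; rewrite EFinM nnfun_muleindic_ge0.
under [RHS]eq_integral => x _.
  rewrite fimfunE -fsumEFin// ge0_mule_fsuml; last by move=> r;
    rewrite EFinM nnfun_muleindic_ge0.
  over.
rewrite ge0_integral_fsum//; last 2 first.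
- by move=> r; exact: emeasurable_funM.
- by move=> r x _; rewrite mule_ge0 // EFinM nnfun_muleindic_ge0.
(* Writing [r] as a value of [h n] makes it nonnegative, hence able to leave the integral. *)
apply: eq_fsbigr => r; rewrite inE => -[x _ <-].
under [RHS]eq_integral do rewrite EFinM -muleA.
rewrite ge0_integralZl//; last 3 first.
- by apply: emeasurable_funM => //; exact/measurable_EFinP.
- by move=> t _; rewrite mule_ge0 // lee_fin.
- by rewrite lee_fin.
under eq_integral do rewrite EFinM.
rewrite integralZl_indic_nnsfun // integral_indic // setIT nuE //; congr (_ * _).
rewrite [LHS]integral_mkcond; apply: eq_integral => t _.
by rewrite epatch_indic muleC.
Qed.

(** Product laws have product densities. Tonelli separates the first coordinate; induction treats
    the others, and the density of the first is inserted last. *)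
Lemma ge0_integral_prod_prob_density n (P Q : 'I_n -> probability T R)
    (rho : 'I_n -> T -> R) (f : n.-tuple T -> \bar R) :
  (forall i, measurable_fun setT (rho i)) -> (forall i x, (0 <= rho i x)%R) ->
  (forall i A, measurable A -> Q i A = \int[P i]_(x in A) (rho i x)%:E) ->
  measurable_fun setT f -> (forall x, 0 <= f x) ->
  \int[prod_prob Q]_x f x =
  \int[prod_prob P]_x (f x * (\prod_i rho i (tnth x i))%:E).
Proof.
elim: n P Q rho f => [|n IH] P Q rho f mrho rho0 rhoE mf f0.
  by apply: eq_integral => x _; rewrite big_ord0 mule1.
have mprod (k : nat) (r : 'I_k -> T -> R) : (forall i, measurable_fun setT (r i)) ->
    measurable_fun setT (fun x : k.-tuple T => (\prod_i r i (tnth x i))%:E).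
  move=> mr; apply/measurable_EFinP; apply: measurable_prod => i _.
  by apply: (measurableT_comp (mr i)); exact: measurable_tnth.
have prod0 (k : nat) (r : 'I_k -> T -> R) (x : k.-tuple T) :
    (forall i y, (0 <= r i y)%R) -> 0 <= (\prod_i r i (tnth x i))%:E.
  by move=> r0; rewrite lee_fin prodr_ge0.
have mtc : measurable_fun setT (@tcons _ T n) by exact: measurable_tcons.
rewrite /= !ge0_integral_distribution //; last 2 first.
- by apply: emeasurable_funM => //; exact: mprod.
- by move=> y; rewrite mule_ge0 // prod0.
have mfr : measurable_fun setT (fun y => f y * (\prod_i rho i (tnth y i))%:E).
  by apply: emeasurable_funM => //; exact: mprod.
have mft : measurable_fun setT (f \o @tcons _ T n) by exact: measurableT_comp.
rewrite !fubini_tonelli1 //; last 3 first.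
- exact: (measurableT_comp mfr).
- by move=> y /=; rewrite mule_ge0 // prod0.
- by move=> y /=.
rewrite /fubini_F.
have mfa a : measurable_fun setT (fun x => f (tcons (a, x))).
  exact: (measurableT_comp mft (pair1_measurable a)).
set g := (fun i => rho (lift ord0 i)).
have g0 i y : (0 <= g i y)%R by exact: rho0.
have mg i : measurable_fun setT (g i) by exact: mrho.
transitivity (\int[Q ord0]_a (\int[prod_prob (fun i => P (lift ord0 i))]_x
   (f (tcons (a, x)) * (\prod_i g i (tnth x i))%:E))).
  apply: eq_integral => a _.
  by apply: (IH (fun i => P (lift ord0 i))) => [i|i y|i A mA||];
    [exact: mrho|exact: rho0|exact: rhoE|exact: mfa|move=> x; exact: f0].
rewrite (ge0_integral_density (mrho ord0) (rho0 ord0) (rhoE ord0)); last 2 first.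
- apply: (@measurable_fun_fubini_tonelli_F _ _ _ _ _
    (prod_prob (fun i => P (lift ord0 i)))
    (fun y => f (tcons y) * (\prod_i g i (tnth y.2 i))%:E)).
    by apply: emeasurable_funM => //; exact: (measurableT_comp (mprod _ g mg)
      measurable_snd).
  by move=> y; rewrite mule_ge0 // prod0.
- by move=> a; apply: integral_ge0 => x _; rewrite mule_ge0 // prod0.
apply: eq_integral => a _.
rewrite muleC -ge0_integralZl //; last 3 first.
- by apply: emeasurable_funM => //; exact: mprod.
- by move=> x _; rewrite mule_ge0 // prod0.
- by rewrite lee_fin.
apply: eq_integral => x _ /=; rewrite big_ord_recl EFinM muleCA; congr (_ * _).
by congr (_%:E * _%:E); apply: eq_bigr => i _; rewrite tnthS.
Qed.

End density.

(** * Likelihood ratio of a Gaussian translation *)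

Section shift.
Context {R : realType}.
Implicit Types (a s c : R).

(** The Cameron-Martin formula in dimension one, read off the quotient of the two normal
    densities. *)
Lemma normal_prob_shift a s c (A : set (measurableTypeR R)) : 0 < s -> measurable A ->
  normal_prob (a + s * c) s A =
  (\int[normal_prob a s]_(x in A) (expR (c * ((x - a) / s) - c ^+ 2 / 2))%:E)%E.
Proof.
move=> s0 mA; pose e x := expR (c * ((x - a) / s) - c ^+ 2 / 2).
have s00 : s != 0 by rewrite gt_eqF.
have me : measurable_fun [set: measurableTypeR R] e.
  apply: measurableT_comp => //; apply: measurable_funB => //.
  by apply: measurable_funM => //; apply: measurable_funM => //; exact: measurable_funB.
rewrite [RHS]integral_mkcond.
rewrite (ge0_integral_density (@measurable_normal_pdf R a s) (normal_pdf_ge0 a s) (mu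
  := lebesgue_measure)) //; last 2 first.
- apply/(measurable_restrictT _ mA)/measurable_funTS; exact/measurable_EFinP.
- by move=> x; rewrite erestrict_ge0 // => y _; rewrite lee_fin expR_ge0.
rewrite /normal_prob [LHS]integral_mkcond; apply: eq_integral => x _.
rewrite !patchE; case: ifP => _; last by rewrite mul0e.
rewrite -EFinM !normal_pdfE // /normal_fun /e mulrCA -expRD; congr (_ * expR _)%:E.
by field.
Qed.

Lemma gaussian_shift d (theta theta' : d.-tuple (measurableTypeR R)) s (c : 'I_d -> R)
  (f : d.-tuple (measurableTypeR R) -> \bar R) : 0 < s ->
  (forall j, tnth theta' j = tnth theta j + s * c j) ->
  measurable_fun setT f -> (forall x, (0 <= f x)%E) ->
  (\int[gaussian theta' s]_x f x =
   \int[gaussian theta s]_x (f x * (expR (\sum_j (c j * ((tnth x j - tnth theta j) / s)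
     - c j ^+ 2 / 2)))%:E))%E.
Proof.
move=> s0 tE mf f0; rewrite /gaussian.
under [RHS]eq_integral do rewrite expR_sum.
rewrite (@ge0_integral_prod_prob_density _ _ _ _
  (fun j => normal_prob (tnth theta j) s) _
  (fun j x => expR (c j * ((x - tnth theta j) / s) - c j ^+ 2 / 2))) //.
- by move=> j; apply: measurableT_comp => //; apply: measurable_funB => //;
    apply: measurable_funM => //; apply: measurable_funM => //; exact: measurable_funB.
- by move=> j A mA; rewrite tE; exact: normal_prob_shift.
Qed.

End shift.

(** A seed independent of the observation leaves the likelihood ratio unchanged. *)
Lemma product_density d1 d2 (T : measurableType d1) (S : measurableType d2)
    (R : realType) (P P' : probability T R) (Q : probability S R) (e : T -> R) (A : set (T * S)) :
  measurable_fun setT e -> (forall x, 0 <= e x) ->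
  (forall f : T -> \bar R, measurable_fun setT f -> (forall x, (0 <= f x)%E) ->
    (\int[P']_x f x = \int[P]_x (f x * (e x)%:E))%E) ->
  measurable A ->
  (P' \x Q)%E A = (\int[P \x Q]_(x in A) (e x.1)%:E)%E.
Proof.
move=> me e0 PP' mA.
have m1 : measurable_fun setT (fun x : T * S => (\1_A x)%:E : \bar R).
  by apply/measurable_EFinP; exact: measurable_indic.
have i0 x : (0 <= (\1_A x)%:E :> \bar R)%E by rewrite lee_fin.
transitivity (\int[P' \x Q]_x (\1_A x)%:E)%E.
  by rewrite integral_indic // setIT.
rewrite [RHS]integral_mkcond.
rewrite fubini_tonelli1 // PP'; last 2 first.
- exact: measurable_fun_fubini_tonelli_F.
- by move=> x; apply: integral_ge0 => u _; rewrite lee_fin.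
transitivity (\int[P \x Q]_x ((\1_A x)%:E * (e x.1)%:E))%E; last first.
  apply: eq_integral => x _; rewrite patchE indicE.
  by case: ifP => _; rewrite ?mul1e ?mul0e.
rewrite fubini_tonelli1 //; last 2 first.
- apply: emeasurable_funM => //; apply/measurable_EFinP;
  exact: (measurableT_comp me measurable_fst).
- by move=> x; rewrite mule_ge0 ?lee_fin.
apply: eq_integral => x _; rewrite /fubini_F /= ge0_integralZr //.
- exact: (measurableT_comp m1 (pair1_measurable x)).
- by rewrite lee_fin.
Qed.

Section observation.
Context {R : realType}.
Context (d : nat) dS (S : measurableType dS) (Q : probability S R).
Local Notation Rd := (d.-tuple (measurableTypeR R)).

Lemma observation_shift (theta theta' : Rd) s (c : 'I_d -> R) (A : set (Rd * S)) :
  0 < s -> (forall j, tnth theta' j = tnth theta j + s * c j) -> measurable A ->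
  (gaussian theta' s \x Q)%E A =
  (\int[gaussian theta s \x Q]_(x in A)
     (expR (\sum_j (c j * ((tnth x.1 j - tnth theta j) / s) - c j ^+ 2 / 2)))%:E)%E.
Proof.
move=> s0 tE mA.
set e := fun x : Rd =>
  expR (\sum_j (c j * ((tnth x j - tnth theta j) / s) - c j ^+ 2 / 2)).
have me : measurable_fun setT e.
  apply: measurableT_comp => //; apply: measurable_sum => j.
  apply: measurable_funB => //; apply: measurable_funM => //;
    apply: measurable_funM => //.
  by apply: measurable_funB => //; exact: measurable_tnth.
have e0 x : 0 <= e x by exact: expR_ge0.
exact: (@product_density _ _ _ _ _ (gaussian theta s) (gaussian theta' s) Q e A me e0
  (fun f mf f0 => gaussian_shift s0 tE mf f0) mA).
Qed.

End observation.

(** * Scores of quantized observations *)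

Section pointwise.
Context {R : realType}.
Implicit Types t w y : R.

(** For [y >= 0], [expR y - 1 <= y * expR y] gives the bound [y ^+ 2 * expR y]; for [y < 0] the
    bound [y ^+ 2] suffices. *)
Lemma expRB1_le y : 0 <= expR y - 1 - y <= y ^+ 2 * (1 + expR y).
Proof.
have h1 := expR_ge1Dx y; have h2 := expR_ge1Dx (- y); have h3 := expR_gt0 y.
have h4 : expR y - 1 <= y * expR y.
  have : (1 - y) * expR y <= 1.
    by rewrite -[leRHS](expRxMexpNx_1 y) mulrC ler_pM2l.
  lra.
apply/andP; split; first lra.
case: (lerP 0 y) => y0.
  have : y * (expR y - 1) <= y * (y * expR y) by rewrite ler_wpM2l.
  have := sqr_ge0 y; lra.
have : (- y) * (1 - expR y) <= (- y) * (- y) by rewrite ler_wpM2l //; lra.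
have : 0 <= y ^+ 2 * expR y by rewrite mulr_ge0 ?sqr_ge0 // ltW.
lra.
Qed.

Lemma sqr_le_expR w : w ^+ 2 <= 2 * (expR w + expR (- w)).
Proof.
have h y : 0 <= y -> y ^+ 2 <= 2 * expR y.
  by move=> y0; have := expR_ge1Dxn 1 y0; rewrite (_ : 2`! = 2)%N //; lra.
have := expR_ge0 w; have := expR_ge0 (- w).
case: (lerP 0 w) => w0; first by have := h _ w0; lra.
have w0' : 0 <= - w by lra.
by have := h _ w0'; rewrite sqrrN; lra.
Qed.

(** Second-order Taylor bound for the likelihood ratio. Everything is measured against
    [u = expR w + expR (- w) >= 2]: [w ^+ 2 <= 2 * u] and [expR y <= u] bound the remainder by
    [8 * t ^+ 2 * u ^+ 2], and [u ^+ 4] is at most 8 times the sum of the fourth powers. *)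
Lemma likelihood_remainder t w : 0 <= t <= 1 ->
  (expR (t * w - t ^+ 2 / 2) - 1 - t * w) ^+ 2 <=
  512 * t ^+ 4 * (expR (4 * w) + expR (- 4 * w)).
Proof.
move=> /andP[t0 t1].
set y := t * w - t ^+ 2 / 2; set u := expR w + expR (- w).
have t2 : 0 <= t ^+ 2 by exact: sqr_ge0.
have t21 : t ^+ 2 <= 1 by rewrite expr_le1.
have ew := expR_gt0 w; have ew' := expR_gt0 (- w).
have u2 : 2 <= u by have := expR_ge1Dx w; have := expR_ge1Dx (- w); rewrite /u; lra.
have wu : w ^+ 2 <= 2 * u by exact: sqr_le_expR.
have y2 : y ^+ 2 <= 5 * t ^+ 2 * u.
  have -> : y ^+ 2 = t ^+ 2 * (w ^+ 2 - t * w + t ^+ 2 / 4) by rewrite /y; field.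
  have -> : 5 * t ^+ 2 * u = t ^+ 2 * (5 * u) by ring.
  rewrite ler_wpM2l //.
  have := sqr_ge0 (w + t); lra.
have ey : expR y <= u.
  have [w0|w0] := lerP 0 w.
    apply: (@le_trans _ _ (expR w)); last by rewrite /u; lra.
    have : 0 <= (1 - t) * w by rewrite mulr_ge0 //; lra.
    by rewrite ler_expR /y; lra.
  apply: (@le_trans _ _ 1); last lra.
  have tw : 0 <= t * (- w) by rewrite mulr_ge0 //; lra.
  by rewrite -[leRHS]expR0 ler_expR /y; lra.
have /andP[h1 h2] := expRB1_le y.
have h3 : y ^+ 2 * (1 + expR y) <= 5 * t ^+ 2 * u * (3 / 2 * u).
  by have ey0 := expR_gt0 y; apply: ler_pM; [exact: sqr_ge0|lra|exact: y2|lra].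
have tu : 4 * t ^+ 2 <= t ^+ 2 * u ^+ 2.
  rewrite mulrC ler_wpM2l //; have -> : 4 = 2 ^+ 2 :> R by ring.
  by rewrite ler_sqr ?nnegrE //; lra.
have r1 : `|expR y - 1 - t * w| <= 8 * (t ^+ 2 * u ^+ 2).
  rewrite ler_norml.
  have -> : expR y - 1 - t * w = expR y - 1 - y - t ^+ 2 / 2 by rewrite /y; ring.
  have : 5 * t ^+ 2 * u * (3 / 2 * u) = 15 / 2 * (t ^+ 2 * u ^+ 2) by field.
  by move=> h4; apply/andP; split; lra.
rewrite -[leLHS]real_normK ?num_real //.
apply: (@le_trans _ _ ((8 * (t ^+ 2 * u ^+ 2)) ^+ 2)).
  by rewrite ler_sqr ?nnegrE //; apply: le_trans r1.
have -> : (8 * (t ^+ 2 * u ^+ 2)) ^+ 2 = 64 * t ^+ 4 * u ^+ 4 by ring.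
have -> : 512 * t ^+ 4 * (expR (4 * w) + expR (- 4 * w)) = 64 * t ^+ 4 * (8 * (expR (4
  * w) + expR (- 4 * w))) by ring.
apply: ler_wpM2l; first by rewrite mulr_ge0 // exprn_ge0.
have e4 v : expR (4 * v) = expR v ^+ 4 by rewrite -expRM_natl.
rewrite (_ : - 4 * w = 4 * - w); last by ring.
rewrite !e4 /u.
have q (a b : R) : (a + b) ^+ 2 <= 2 * (a ^+ 2 + b ^+ 2).
  by have := sqr_ge0 (a - b); lra.
have -> : (expR w + expR (- w)) ^+ 4 = ((expR w + expR (- w)) ^+ 2) ^+ 2 by rewrite
  -exprM.
apply: (@le_trans _ _ ((2 * (expR w ^+ 2 + expR (- w) ^+ 2)) ^+ 2)).
  by rewrite ler_sqr ?nnegrE ?sqr_ge0 ?mulr_ge0 ?addr_ge0 ?sqr_ge0.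
by have := q (expR w ^+ 2) (expR (- w) ^+ 2); rewrite exprMn -!exprM; lra.
Qed.

End pointwise.

Section Rintegral_extra.
Context dO (O : measurableType dO) (R : realType) (P : probability O R).
Implicit Types (A : set O) (f g : O -> R).

Let integrableS' A f : measurable A -> P.-integrable setT (EFin \o f) ->
  P.-integrable A (EFin \o f).
Proof. by move=> mA; apply: integrableS. Qed.

Lemma Rintegral_sumZ (I : Type) (r : seq I) A (c : I -> R) (f : I -> O -> R) :
  measurable A ->
  (forall i, P.-integrable setT (EFin \o f i)) ->
  P.-integrable setT (EFin \o (fun x => \sum_(i <- r) c i * f i x)) /\
  \int[P]_(x in A) (\sum_(i <- r) c i * f i x) = \sum_(i <- r) c i * \int[P]_(x in A) f
    i x.
Proof.
move=> mA fi; elim: r => [|i r [IH1 IH2]].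
  split; last by rewrite big_nil; under eq_Rintegral do rewrite big_nil;
    rewrite Rintegral_cst // mul0r.
  by under eq_fun do rewrite big_nil; exact: integrable0.
have fZ : P.-integrable setT (EFin \o (fun x => c i * f i x)).
  by rewrite (_ : _ \o _ = fun x => (c i)%:E * (f i x)%:E)%E //;
    apply: integrableZl => //; exact: fi.
split.
  under eq_fun do rewrite big_cons.
  by rewrite (_ : _ \o _ = fun x => (c i * f i x)%:E + (\sum_(j <- r) c j * f j
    x)%:E)%E //; exact: integrableD.
under eq_Rintegral do rewrite big_cons.
by rewrite RintegralD // ?big_cons ?IH2 ?RintegralZl //; exact: integrableS'.
Qed.

(** The integral over [A] of the square of [f - b] is nonnegative for every [b]; take
    [b = e / p]. *)
Lemma Rintegral_CauchySchwarz1 A f : measurable A ->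
  P.-integrable setT (EFin \o f) -> P.-integrable setT (EFin \o (fun x => f x ^+ 2)) ->
  (\int[P]_(x in A) f x) ^+ 2 <= fine (P A) * \int[P]_(x in A) (f x ^+ 2).
Proof.
move=> mA fi f2i; set e := \int[P]_(x in A) f x; set p := fine (P A);
  set v := \int[P]_(x in A) _.
have i1 : P.-integrable setT (EFin \o (fun=> 1 : R)) by exact:
  finite_measure_integrable_cst.
have h b : 0 <= v - 2 * b * e + b ^+ 2 * p.
  have -> : v - 2 * b * e + b ^+ 2 * p =
      \int[P]_(x in A) (\sum_(i < 3) nth 0 [:: 1; - 2 * b; b ^+ 2] i *
        nth (fun=> 0) [:: fun x => f x ^+ 2; f; fun=> 1] i x).
    rewrite (Rintegral_sumZ _ _ mA _).2 => [|[[|[|[|]]] //]].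
    by rewrite !big_ord_recl big_ord0 /= Rintegral_cst // -/p -/v -/e; ring.
  apply: Rintegral_ge0 => x _; rewrite !big_ord_recl big_ord0 /=.
  by have := sqr_ge0 (f x - b); lra.
have p0 : 0 <= p by exact: fine_ge0.
have [->|e0] := eqVneq e 0; first by rewrite expr0n /= mulr_ge0 // Rintegral_ge0 // =>
  x _; exact: sqr_ge0.
move: p0; rewrite le_eqVlt => /orP[/eqP p0|p0].
  (* For [p = 0] and [e != 0] the quadratic is affine in [b]; this [b] would give it the value
     -1. *)
  have := h ((v + 1) / (2 * e)); rewrite -p0 mulr0 addr0.
  by have -> : v - 2 * ((v + 1) / (2 * e)) * e = -1; [field|lra].
have := h (e / p); have -> : v - 2 * (e / p) * e + (e / p) ^+ 2 * p = (p * v - e ^+ 2)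
  / p.
  by field; rewrite gt_eqF.
by rewrite pmulr_lge0 ?invr_gt0 // subr_ge0.
Qed.

Lemma sum_Rintegral_preimage (Z : finType) (phi : O -> Z) f :
  (forall z, measurable (phi @^-1` [set z])) ->
  P.-integrable setT (EFin \o f) ->
  \sum_z \int[P]_(x in phi @^-1` [set z]) f x = \int[P]_x f x.
Proof.
move=> mphi fi.
transitivity (\sum_z \int[P]_x (f x * \1_(phi @^-1` [set z]) x)).
  apply: eq_bigr => z _; rewrite Rintegral_mkcond; congr fine;
    apply: eq_integral => x _.
  by rewrite patchE indicE; case: ifP => _; rewrite ?mulr1 ?mulr0.
have gi z : P.-integrable setT (EFin \o (fun x => f x * \1_(phi @^-1` [set z]) x)).
  have /(integrable_mkcond _ (mphi z)).1 : P.-integrable (phi @^-1` [set z]) (EFin \o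
    f) by exact: integrableS'.
  apply: eq_integrable => // x _; rewrite patchE /= indicE.
  by case: ifP => _; rewrite ?mulr1 ?mulr0.
transitivity (\sum_z 1 * \int[P]_x (f x * \1_(phi @^-1` [set z]) x)).
  by apply: eq_bigr => z _; rewrite mul1r.
rewrite -(Rintegral_sumZ _ (fun=> 1) measurableT gi).2.
apply: eq_Rintegral => x _; rewrite (bigD1 (phi x)) //= big1 ?addr0 ?mul1r.
  by rewrite indicE mem_set ?mulr1.
by move=> z zx; rewrite indicE memNset ?mulr0 //= => e; rewrite e eqxx in zx.
Qed.

End Rintegral_extra.

Section gaussian_scores.
Context dO (O : measurableType dO) (R : realType) (P : probability O R).
Context (d : nat) (W : 'I_d -> O -> R).
Hypothesis mW : forall j, measurable_fun setT (W j).
(** The noise enters as a standard Gaussian vector through its Laplace transform. *)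
Hypothesis expW : forall c : 'I_d -> R,
  (\int[P]_x (expR (\sum_j (c j * W j x - c j ^+ 2 / 2)))%:E = 1)%E.

Let int1 (r : R) : P.-integrable setT (EFin \o (fun=> r)).
Proof. exact: finite_measure_integrable_cst. Qed.

Let mexpW j a : measurable_fun setT (fun x => expR (a * W j x)).
Proof. by apply: measurableT_comp => //; exact: measurable_funM. Qed.

Let expW1 j a : (\int[P]_x (expR (a * W j x))%:E = (expR (a ^+ 2 / 2))%:E)%E.
Proof.
have h x : expR (a * W j x) = expR (a ^+ 2 / 2) *
    expR (\sum_l ((if l == j then a else 0) * W l x - (if l == j then a else 0) ^+ 2 /
      2)).
  rewrite (bigD1 j) //= eqxx big1 => [|l /negbTE ->];
    last by rewrite expr0n /= !mul0r subrr.
  by rewrite -expRD; congr expR; ring.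
under eq_integral do rewrite h EFinM.
rewrite ge0_integralZl ?lee_fin ?expR_ge0 //; first by rewrite expW mule1.
apply/measurable_EFinP; apply: measurableT_comp => //; apply: measurable_sum => l.
by apply: measurable_funB => //; exact: measurable_funM.
Qed.

Let int_expW j a : P.-integrable setT (EFin \o (fun x => expR (a * W j x))).
Proof.
apply/integrableP; split; first exact/measurable_EFinP.
under eq_integral do rewrite /= ger0_norm ?expR_ge0 //.
by rewrite expW1 ltry.
Qed.

(** Envelope that dominates the functions of a single score to be integrated, with explicit
    integral. *)
Let U j a x := expR (a * W j x) + expR (- a * W j x).

Let int_U j a C : P.-integrable setT (EFin \o (fun x => C * U j a x)).
Proof.
rewrite (_ : _ \o _ = fun x => C%:E * (U j a x)%:E)%E //; apply: integrableZl => //.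
rewrite (_ : (fun _ => _) =
  fun x => (expR (a * W j x))%:E + (expR (- a * W j x))%:E)%E //.
by apply: integrableD => //; exact: int_expW.
Qed.

Let dominated j a C (f : O -> R) :
  measurable_fun setT f -> (forall x, `|f x| <= C * U j a x) ->
  P.-integrable setT (EFin \o f).
Proof.
move=> mf fU; apply: (le_integrable _ _ _ (int_U j a C)) => //;
  first exact/measurable_EFinP.
by move=> x _; rewrite /= lee_fin; apply: (le_trans (fU x)); exact: ler_norm.
Qed.

Let Rintegral_U j a C : \int[P]_x (C * U j a x) = 2 * C * expR (a ^+ 2 / 2).
Proof.
have iU : P.-integrable setT (EFin \o U j a).
  apply: eq_integrable (int_U j a 1) => // x _ /=; by rewrite mul1r.
rewrite RintegralZl // RintegralD //.
by rewrite /Rintegral !expW1 sqrrN /=; ring.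
Qed.

Lemma integrable_score j : P.-integrable setT (EFin \o W j).
Proof.
apply: (@dominated j 1 1) => // x; rewrite mul1r /U mulN1r mul1r ler_norml.
have := expR_ge1Dx (W j x); have := expR_ge1Dx (- W j x).
have := expR_ge0 (W j x); have := expR_ge0 (- W j x).
by move=> *; apply/andP; split; lra.
Qed.

Lemma integrable_score_sqr j : P.-integrable setT (EFin \o (fun x => W j x ^+ 2)).
Proof.
apply: (@dominated j 1 2); first exact: measurable_funX.
move=> x; rewrite ger0_norm ?sqr_ge0 // /U mulN1r mul1r; exact: sqr_le_expR.
Qed.

(** The envelope gives [4 * expR (1 / 2)], and [expR (1 / 2) <= 2]. *)
Lemma score_second_moment_le j : \int[P]_x (W j x ^+ 2) <= 8.
Proof.
apply: (@le_trans _ _ (\int[P]_x (2 * U j 1 x))).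
  have iW2 := integrable_score_sqr j; apply: le_Rintegral => // x _;
    rewrite /U mulN1r mul1r; exact: sqr_le_expR.
rewrite Rintegral_U expr1n.
have := expR_ge1Dx (- (1 / 2) : R); rewrite expRN => h.
have h0 := expR_gt0 (1 / 2 : R).
have : 1 / 2 * expR (1 / 2) <= 1 :> R by rewrite -ler_pdivlMr // [leRHS]div1r; lra.
lra.
Qed.

Section likelihood_ratio.
Variables (t : R) (j : 'I_d).
Hypothesis t01 : 0 <= t <= 1.

Let L x := expR (t * W j x - t ^+ 2 / 2).
Let Rem x := L x - 1 - t * W j x.

Let mL : measurable_fun setT L.
Proof. by apply: measurableT_comp => //; apply: measurable_funB => //;
  exact: measurable_funM. Qed.

Let mRem : measurable_fun setT Rem.
Proof. by apply: measurable_funB; [exact: measurable_funB|exact: measurable_funM]. Qed.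

Let int_L : P.-integrable setT (EFin \o L).
Proof.
apply: (@dominated j t 1) => // x; rewrite mul1r ger0_norm ?expR_ge0 //.
have := expR_ge0 (- t * W j x); have : L x <= expR (t * W j x); last by rewrite /U; lra.
by rewrite ler_expR; have := sqr_ge0 t; lra.
Qed.

Let int_Rem : P.-integrable setT (EFin \o Rem).
Proof.
rewrite (_ : _ \o _ = fun x => ((L x)%:E - 1%:E) - t%:E * (W j x)%:E)%E //.
apply: integrableB => //; first by apply: integrableB => //; exact: int1.
by apply: integrableZl => //; exact: integrable_score.
Qed.

Let Rem2_le x : Rem x ^+ 2 <= 512 * t ^+ 4 * U j 4 x.
Proof. exact: likelihood_remainder. Qed.

Lemma integrable_remainder_sqr : P.-integrable setT (EFin \o (fun x => Rem x ^+ 2)).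
Proof.
apply: (@dominated j 4 (512 * t ^+ 4)); first exact: measurable_funX.
by move=> x; rewrite ger0_norm ?sqr_ge0.
Qed.

(** The factor [expR 8] is the exponential moment at [a = 4], since [4 ^+ 2 / 2 = 8]. *)
Lemma remainder_le : \int[P]_x (Rem x ^+ 2) <= 1024 * expR 8 * t ^+ 4.
Proof.
apply: (@le_trans _ _ (\int[P]_x (512 * t ^+ 4 * U j 4 x))).
  by have i2 := integrable_remainder_sqr; apply: le_Rintegral => // x _; exact: Rem2_le.
rewrite Rintegral_U (_ : 4 ^+ 2 / 2 = 8); last by field.
by apply: eq_imp_le; ring.
Qed.

(** Split [L - 1] into [t * W j] and the remainder, use [(x + y)^2 <= 2 x^2 + 2 y^2], and apply
    Cauchy-Schwarz to the remainder on [A]. *)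
Lemma likelihood_increment A : measurable A ->
  (\int[P]_(x in A) L x - fine (P A)) ^+ 2 <=
  2 * t ^+ 2 * (\int[P]_(x in A) W j x) ^+ 2 +
  2 * fine (P A) * \int[P]_(x in A) (Rem x ^+ 2).
Proof.
move=> mA; have iW := integrable_score j.
have -> : \int[P]_(x in A) L x - fine (P A) =
    t * \int[P]_(x in A) W j x + \int[P]_(x in A) Rem x.
  have iA (f : O -> R) : P.-integrable setT (EFin \o f) -> P.-integrable A (EFin \o f)
    by exact: integrableS.
  have -> : \int[P]_(x in A) Rem x = \int[P]_(x in A) L x - fine (P A) - t * \int[P]_(x
    in A) W j x.
    rewrite RintegralB //; last 2 first.
    - by apply: iA; rewrite (_ : _ \o _ = fun x => (L x)%:E - 1%:E)%E //;
      apply: integrableB => //; exact: int1.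
    - apply: iA; rewrite (_ : _ \o _ = fun x => t%:E * (W j x)%:E)%E //.
      by apply: integrableZl => //; exact: integrable_score.
    rewrite RintegralB ?RintegralZl ?Rintegral_cst ?mul1r //;
      by [exact: iA|apply: iA; exact: int1].
  by ring.
have := Rintegral_CauchySchwarz1 mA int_Rem integrable_remainder_sqr.
set x := \int[P]_(x in A) W j x; set y := \int[P]_(x in A) Rem x.
have := sqr_ge0 (t * x - y); lra.
Qed.

End likelihood_ratio.

(* Jensen's inequality for the exponential moment of [c . W] conditioned on
   [A], with [c] the conditional mean of [W]. *)
Lemma level_inequality A : measurable A ->
  \sum_j (\int[P]_(x in A) W j x) ^+ 2 <= 2 * fine (P A) ^+ 2 * - ln (fine (P A)).
Proof.
move=> mA; set e := fun j => \int[P]_(x in A) W j x; set p := fine (P A).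
have : 0 <= p by exact: fine_ge0.
rewrite le_eqVlt => /orP[/eqP p0|p0].
  rewrite big1 => [|j _]; first by rewrite -p0 expr0n /= mulr0 mul0r.
  have := Rintegral_CauchySchwarz1 mA (integrable_score j) (integrable_score_sqr j).
  by rewrite -/p -p0 mul0r => h; apply/eqP; rewrite eq_le h sqr_ge0.
pose c j := e j / p.
pose y x := \sum_j (c j * W j x - c j ^+ 2 / 2).
pose a := \sum_j (e j ^+ 2 / (2 * p ^+ 2)).
have my : measurable_fun setT y.
  by apply: measurable_sum => l; apply: measurable_funB => //; exact: measurable_funM.
have i_y : P.-integrable setT (EFin \o (fun x => expR (y x))).
  apply/integrableP; split; first by apply/measurable_EFinP; exact: measurableT_comp.
  under eq_integral do rewrite /= ger0_norm ?expR_ge0 //.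
  by rewrite expW ltry.
have iA (f : O -> R) : P.-integrable setT (EFin \o f) -> P.-integrable A (EFin \o f) by
  exact: integrableS.
have [i_lin E_lin] := Rintegral_sumZ (index_enum 'I_d) (fun j => expR a * c j) mA
  integrable_score.
pose k := expR a * (1 - a - \sum_j c j ^+ 2 / 2).
(* [a] is the conditional mean of [y] given [A], and [g] is the tangent line of the exponential at
   [a], evaluated at [y]. Its integral over [A] is [expR a * p], so that [expR a * p <= 1]. *)
pose g x := k + \sum_j expR a * c j * W j x.
have i_g : P.-integrable setT (EFin \o g).
  rewrite (_ : _ \o _ = fun x => k%:E + (\sum_j expR a * c j * W j x)%:E)%E //.
  by apply: integrableD => //; exact: int1.
have ea0 := expR_gt0 a.
have lin x : g x = expR a * (1 + y x - a).
  rewrite /g /k /y sumrB.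
  have -> : \sum_j expR a * c j * W j x = expR a * \sum_j c j * W j x.
    by rewrite mulr_sumr; apply: eq_bigr => j _; ring.
  by ring.
have h1 : \int[P]_(x in A) g x <= 1.
  apply: (@le_trans _ _ (\int[P]_(x in A) expR (y x))).
    apply: le_Rintegral => //; [exact: iA|exact: iA|].
    move=> x _; rewrite lin.
    have -> : expR (y x) = expR a * expR (y x - a) by rewrite -expRD; congr expR; ring.
    by rewrite ler_pM2l //; have := expR_ge1Dx (y x - a); lra.
  apply: (@le_trans _ _ (\int[P]_x expR (y x))).
    rewrite /Rintegral fine_le //.
    - by apply: integrable_fin_num => //; exact: iA.
    - exact: integrable_fin_num.
    - apply: ge0_subset_integral => //.
      by apply/measurable_EFinP; exact: measurableT_comp.
  by rewrite /Rintegral expW.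
move: h1; rewrite RintegralD; [|done|by apply: iA; exact: int1|exact: iA].
rewrite E_lin Rintegral_cst // -/p /k.
have -> : \sum_j expR a * c j * \int[P]_(x in A) W j x = expR a * p * (2 * a).
  rewrite /a !mulr_sumr; apply: eq_bigr => j _; rewrite -/(e j) /c.
  by field; rewrite gt_eqF.
have -> : \sum_j c j ^+ 2 / 2 = a.
  by apply: eq_bigr => j _; rewrite /c; field; rewrite gt_eqF.
move=> h.
have {}h : expR a * p <= 1 by lra.
have ha : a <= - ln p.
  rewrite -lnV ?posrE // -ler_expR lnK ?posrE ?invr_gt0 //.
  by rewrite -div1r ler_pdivlMr.
have -> : \sum_j e j ^+ 2 = 2 * p ^+ 2 * a.
  by rewrite /a mulr_sumr; apply: eq_bigr => j _; field; rewrite gt_eqF.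
by rewrite ler_pM2l // mulr_gt0 // exprn_gt0.
Qed.

End gaussian_scores.

Section partition.
Context dO (O : measurableType dO) (R : realType) (P : probability O R).
Context (d : nat) (W : 'I_d -> O -> R).
Hypothesis mW : forall j, measurable_fun setT (W j).
Hypothesis expW : forall c : 'I_d -> R,
  (\int[P]_x (expR (\sum_j (c j * W j x - c j ^+ 2 / 2)))%:E = 1)%E.
Context (Z : finType) (phi : O -> Z).
Hypothesis mphi : forall z, measurable (phi @^-1` [set z]).

(** [p] and [q t j] are the laws of the message before and after coordinate [j] of the mean moves by
    [t] standard deviations; [e j z / p z] is the mean noise given the message. *)
Let p z := fine (P (phi @^-1` [set z])).
Let q t j z := \int[P]_(x in phi @^-1` [set z]) expR (t * W j x - t ^+ 2 / 2).
Let e j z := \int[P]_(x in phi @^-1` [set z]) W j x.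
Let rem t j z :=
  \int[P]_(x in phi @^-1` [set z]) (expR (t * W j x - t ^+ 2 / 2) - 1 - t * W j x) ^+ 2.

Let p0 z : 0 <= p z. Proof. exact: fine_ge0. Qed.

Let rem0 t j z : 0 <= rem t j z.
Proof. by apply: Rintegral_ge0 => x _; exact: sqr_ge0. Qed.

Let rem_le t j : 0 <= t <= 1 -> \sum_z rem t j z <= 1024 * expR 8 * t ^+ 4.
Proof.
move=> t01; apply: le_trans (remainder_le mW expW j t01).
by rewrite (sum_Rintegral_preimage mphi) //; exact: integrable_remainder_sqr.
Qed.

Let e2_le j z : e j z ^+ 2 <= p z * \int[P]_(x in phi @^-1` [set z]) W j x ^+ 2.
Proof. by apply: Rintegral_CauchySchwarz1 => //;
  [exact: integrable_score|exact: integrable_score_sqr]. Qed.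

(** Absolute continuity: when [p z = 0], the increment bound forces [q t j z = 0]. *)
Lemma likelihood_ratioE t j z : 0 <= t <= 1 -> q t j z = p z * (1 + (q t j z / p z -
  1)).
Proof.
move=> t01; have [pz|pz] := eqVneq (p z) 0; last by field.
rewrite pz mul0r; have := likelihood_increment mW expW j t01 (mphi z).
have := e2_le j z; rewrite -/(p z) -/(e j z) -/(q t j z) pz mulr0 !mul0r addr0 subr0 =>
  h1 h2.
have : q t j z ^+ 2 <= 0.
  by apply: le_trans h2 _; rewrite mulr_ge0_le0 // mulr_ge0 // sqr_ge0.
by move=> h; apply/eqP; rewrite -sqrf_eq0 eq_le h sqr_ge0.
Qed.

Let chi_le t j z : 0 <= t <= 1 ->
  p z * (q t j z / p z - 1) ^+ 2 <= 2 * t ^+ 2 * (e j z ^+ 2 / p z) + 2 * rem t j z.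
Proof.
move=> t01; have [pz|pz] := eqVneq (p z) 0.
  by rewrite pz mul0r invr0 !mulr0 add0r mulr_ge0.
have pz0 : 0 < p z by rewrite lt_def pz p0.
rewrite -(ler_pM2l pz0).
have -> : p z * (p z * (q t j z / p z - 1) ^+ 2) = (q t j z - p z) ^+ 2 by field.
apply: le_trans (likelihood_increment mW expW j t01 (mphi z)) _.
rewrite -/(p z) -/(e j z) -/(rem t j z).
by apply: eq_imp_le; field.
Qed.

(** By Cauchy-Schwarz on each cell, the sum of [e j z ^+ 2 / p z] is at most the second moment of
    [W j], hence at most 8. *)
Lemma chi_square_le t j : 0 <= t <= 1 ->
  \sum_z p z * (q t j z / p z - 1) ^+ 2 <= 16 * t ^+ 2 + 2048 * expR 8 * t ^+ 4.
Proof.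
move=> t01; apply: le_trans (ler_sum _ (fun z _ => chi_le j z t01)) _.
rewrite big_split /= -!mulr_sumr; apply: lerD; last by have := rem_le j t01; lra.
have -> : 16 * t ^+ 2 = 2 * t ^+ 2 * 8 by ring.
have t20 : 0 <= 2 * t ^+ 2 by have := sqr_ge0 t; lra.
apply: ler_wpM2l => //.
apply: le_trans (score_second_moment_le mW expW j).
rewrite -(sum_Rintegral_preimage mphi); last exact: integrable_score_sqr.
apply: ler_sum => z _; have [pz|pz] := eqVneq (p z) 0.
  by rewrite pz invr0 mulr0 Rintegral_ge0 // => x _; exact: sqr_ge0.
by rewrite ler_pdivrMr ?lt_def ?pz ?p0 // mulrC e2_le.
Qed.

(** The level inequality bounds the sum over [j] of [e j z ^+ 2 / p z] by [- 2 * p z * ln (p z)];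
    summing over [z] gives twice the entropy. *)
Lemma sum_chi_square_le t : 0 <= t <= 1 ->
  \sum_j \sum_z p z * (q t j z / p z - 1) ^+ 2 <=
  4 * t ^+ 2 * entropy p + d%:R * (2048 * expR 8 * t ^+ 4).
Proof.
move=> t01.
apply: (@le_trans _ _ (\sum_j (2 * t ^+ 2 * (\sum_z e j z ^+ 2 / p z) + 2048 * expR 8 *
  t ^+ 4))).
  apply: ler_sum => j _; apply: le_trans (ler_sum _ (fun z _ => chi_le j z t01)) _.
  by rewrite big_split /= -!mulr_sumr; apply: lerD => //; have := rem_le j t01; lra.
rewrite big_split /= sumr_const card_ord; apply: lerD;
  last by rewrite -[leLHS]mulr_natl.
rewrite -mulr_sumr.
have -> : 4 * t ^+ 2 * entropy p = 2 * t ^+ 2 * (2 * entropy p) by ring.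
have t20 : 0 <= 2 * t ^+ 2 by have := sqr_ge0 t; lra.
apply: ler_wpM2l => //; rewrite exchange_big /= /entropy mulr_sumr.
apply: ler_sum => z _; rewrite -mulr_suml.
have [pz|pz] := eqVneq (p z) 0; first by rewrite pz invr0 mulr0 mul0r oppr0 mulr0.
rewrite ler_pdivrMr ?lt_def ?pz ?p0 //.
apply: le_trans (level_inequality mW expW (mphi z)) _.
by rewrite -/(p z); apply: eq_imp_le; ring.
Qed.

End partition.

Section machine.
Context {R : realType} (d : nat) dS (S : measurableType dS) (Q : probability S R).
Local Notation Rd := (d.-tuple (measurableTypeR R)).
Context (Z : finType) (phi : Rd * S -> Z).
Hypothesis mphi : forall z, measurable (phi @^-1` [set z]).
Context (s : R) (s0 : 0 < s).

Definition message_prob (theta : Rd) (z : Z) : R :=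
  fine ((gaussian theta s \x Q)%E (phi @^-1` [set z])).

Lemma message_prob_ge0 theta z : 0 <= message_prob theta z.
Proof. exact: fine_ge0. Qed.

Lemma sum_message_prob theta : \sum_z message_prob theta z = 1.
Proof.
transitivity (\sum_z \int[(gaussian theta s \x Q)%E]_(x in phi @^-1` [set z]) (1 : R)).
  by apply: eq_bigr => z _; rewrite Rintegral_cst // mul1r.
rewrite sum_Rintegral_preimage //; last exact: finite_measure_integrable_cst.
by rewrite Rintegral_cst // mul1r; exact: (congr1 fine (probability_setT _)).
Qed.

Variable theta : Rd.
Let W (j : 'I_d) (x : Rd * S) := (tnth x.1 j - tnth theta j) / s.

Let mW j : measurable_fun setT (W j).
Proof.
apply: measurable_funM => //; apply: measurable_funB => //.
exact: (measurableT_comp (measurable_tnth j) measurable_fst).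
Qed.

(** The integrand is the density of a translated observation law, whose mass is 1. *)
Let expW (c : 'I_d -> R) :
  (\int[gaussian theta s \x Q]_x (expR (\sum_j (c j * W j x - c j ^+ 2 / 2)))%:E = 1)%E.
Proof.
pose theta' : Rd := [tuple tnth theta j + s * c j | j < d].
have tE j : tnth theta' j = tnth theta j + s * c j by rewrite tnth_mktuple.
by rewrite -(observation_shift Q s0 tE measurableT); exact: probability_setT.
Qed.

Let message_prob_shift (theta' : Rd) h j z :
  (forall l, tnth theta' l = tnth theta l + (if l == j then h else 0)) ->
  message_prob theta' z =
  \int[(gaussian theta s \x Q)%E]_(x in phi @^-1` [set z])
    expR (h / s * W j x - (h / s) ^+ 2 / 2).
Proof.
move=> tE; pose c l := if l == j then h / s else 0.
have tE' l : tnth theta' l = tnth theta l + s * c l.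
  by rewrite tE /c; case: eqP => _; [congr (_ + _); field;
    rewrite gt_eqF|rewrite mulr0].
rewrite /message_prob (observation_shift Q s0 tE' (mphi z)); congr fine.
apply: eq_integral => x _; congr (expR _)%:E.
rewrite (bigD1 j) //= big1 => [|l /negbTE lj]; first by rewrite /c eqxx addr0.
by rewrite /c lj expr0n /= !mul0r subrr.
Qed.

Section shifted.
Context (h : R) (thetas : 'I_d -> Rd).
Hypothesis h01 : 0 <= h / s <= 1.
Hypothesis thetasE :
  forall j l, tnth (thetas j) l = tnth theta l + (if l == j then h else 0).

Local Notation p := (message_prob theta).
Local Notation r j z := (message_prob (thetas j) z / message_prob theta z - 1).

Lemma message_ratio j z : message_prob (thetas j) z = p z * (1 + r j z).
Proof.
rewrite (message_prob_shift _ (thetasE j));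
  exact: (likelihood_ratioE mW expW mphi j z h01).
Qed.

Lemma message_chi_square_le j :
  \sum_z p z * r j z ^+ 2 <= 16 * (h / s) ^+ 2 + 2048 * expR 8 * (h / s) ^+ 4.
Proof.
under eq_bigr do rewrite (message_prob_shift _ (thetasE j)).
exact: (chi_square_le mW expW mphi j h01).
Qed.

Lemma sum_message_chi_square_le :
  \sum_j \sum_z p z * r j z ^+ 2 <=
  4 * (h / s) ^+ 2 * entropy p + d%:R * (2048 * expR 8 * (h / s) ^+ 4).
Proof.
under eq_bigr => j _ do
  under eq_bigr do rewrite (message_prob_shift _ (thetasE j)).
exact: (sum_chi_square_le mW expW mphi h01).
Qed.

End shifted.
End machine.

(** * Bayes risk of a protocol under the grid prior *)

(** The first component acts through finitely many values. With the second one left in the outer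
    integral, the decoder seed can be frozen. *)
Lemma integral_finite_fst d1 d2 (T1 : measurableType d1) (T2 : measurableType d2)
    (R : realType) (P1 : probability T1 R) (P2 : probability T2 R) (Z : finType)
    (tau : T1 -> Z) (g : Z -> T2 -> R) :
  (forall z, measurable (tau @^-1` [set z])) ->
  (forall z, measurable_fun setT (g z)) -> (forall z v, 0 <= g z v) ->
  (\int[P1 \x P2]_w (g (tau w.1) w.2)%:E =
   \int[P2]_v (\sum_z fine (P1 (tau @^-1` [set z])) * g z v)%:E)%E.
Proof.
move=> mtau mg g0.
have gE w : g (tau w.1) w.2 = \sum_z \1_(tau @^-1` [set z]) w.1 * g z w.2.
  rewrite (bigD1 (tau w.1)) //= indicE mem_set // mul1r big1 ?addr0 // => z zw.
  by rewrite indicE memNset ?mul0r //= => e; rewrite e eqxx in zw.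
have mf : measurable_fun setT (fun w : T1 * T2 => (g (tau w.1) w.2)%:E).
  apply/measurable_EFinP; rewrite (funext gE); apply: measurable_sum => z.
  apply: measurable_funM; last exact: (measurableT_comp (mg z) measurable_snd).
  exact: (measurableT_comp (measurable_indic (mtau z)) measurable_fst).
have f0 (w : T1 * T2) : (0 <= (g (tau w.1) w.2)%:E)%E by rewrite lee_fin.
rewrite fubini_tonelli1 // fubini_tonelli //.
apply: eq_integral => v _; rewrite /fubini_G /=.
under eq_integral => x _ do rewrite (gE (x, v)) -sumEFin /=.
rewrite ge0_integral_sum //; last 2 first.
- move=> z; apply/measurable_EFinP; apply: measurable_funM => //;
  exact: measurable_indic.
- by move=> z x _; rewrite lee_fin mulr_ge0.
rewrite -sumEFin; apply: eq_bigr => z _.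
under eq_integral do rewrite EFinM.
rewrite ge0_integralZr //; last 2 first.
- by apply/measurable_EFinP; exact: measurable_indic.
- by rewrite lee_fin.
by rewrite integral_indic // setIT EFinM fineK // fin_num_measure.
Qed.

Lemma fine_product_prob d1 d2 (T1 : measurableType d1) (T2 : measurableType d2)
    (R : realType) (P1 : probability T1 R) (P2 : probability T2 R) (A : set (T1 * T2)) :
  measurable A -> (P1 \x P2)%E A = (fine ((P1 \x P2)%E A))%:E.
Proof.
move=> mA; pose P : probability (T1 * T2)%type R := (P1 \x P2)%E.
exact: (esym (fineK (fin_num_measure P A mA))).
Qed.

Section risk.
Context {R : realType} (d m : nat) (b : 'I_m -> nat) (p : @protocol R d m b).
Context (sigma : R).
Local Notation Rd := (d.-tuple (measurableTypeR R)).

Let bit_law (theta : Rd) i y := message_prob (seed_law p i) (@encode _ _ _ _ p i) sigma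
  theta y.

Lemma measurable_tuple_bool_set1 n (z : n.-tuple bool) : measurable [set z].
Proof.
have -> : [set z] = \bigcap_(i in [set: 'I_n]) ((fun x => tnth x i) @^-1` [set tnth z
  i]).
  apply/seteqP; split => [x -> //|x h].
  by apply: eq_from_tnth => i; exact: (h i I).
apply: fin_bigcap_measurable => // i _.
by rewrite -[X in measurable X]setTI; exact: measurable_tnth.
Qed.

Lemma measurable_encode_preimage i z : measurable (@encode _ _ _ _ p i @^-1` [set z]).
Proof.
rewrite -[X in measurable X]setTI.
by apply: measurable_encode => //; exact: measurable_tuple_bool_set1.
Qed.

Let tau (x : m.-tuple (Rd * seed p)) : transcript b := [ffun i => @encode _ _ _ _ p i
  (tnth x i)].

Let tauE z : tau @^-1` [set z] =
  [set x | forall i, (@encode _ _ _ _ p i @^-1` [set z i]) (tnth x i)].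
Proof.
apply/seteqP; split => x /= => [<- i|h]; first by rewrite ffunE.
by apply/ffunP => i; rewrite ffunE h.
Qed.

Let mtau z : measurable (tau @^-1` [set z]).
Proof.
have -> : tau @^-1` [set z] = \bigcap_(i in [set: 'I_m])
    ((fun x => tnth x i) @^-1` (@encode _ _ _ _ p i @^-1` [set z i])).
  by rewrite tauE; apply/seteqP; split => x h i; [move=> _; exact: h|exact: (h i I)].
apply: fin_bigcap_measurable => // i _; rewrite -[X in measurable X]setTI.
by apply: measurable_tnth => //; exact: measurable_encode_preimage.
Qed.

Let tau_law theta z :
  fine (prod_prob (fun i => gaussian theta sigma \x seed_law p i)%E
          (tau @^-1` [set z])) =
  \prod_i @bit_law theta i (z i).
Proof.
have mA i : measurable (@encode _ _ _ _ p i @^-1` [set z i]).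
  exact: measurable_encode_preimage.
have := prod_probE (fun i => gaussian theta sigma \x seed_law p i)%E mA.
rewrite tauE => ->.
transitivity (fine (\prod_i (@bit_law theta i (z i))%:E)%E).
  by congr fine; apply: eq_bigr => i _; exact: fine_product_prob.
by rewrite -(big_morph _ (@EFinM R) (erefl 1%E)).
Qed.

Lemma riskE theta : risk p sigma theta =
  (\int[dec_seed_law p]_v (\sum_(z : transcript b) (\prod_i @bit_law theta i (z i)) *
     sq_dist (decode z v) theta)%:E)%E.
Proof.
rewrite /risk unlock /sample_law.
have := @integral_finite_fst _ _ _ _ R
  (prod_prob (fun i => gaussian theta sigma \x seed_law p i)%E) (dec_seed_law p)
  (transcript b) tau (fun z v => sq_dist (decode z v) theta) mtau.
move=> h; rewrite [LHS]h.
- by apply: eq_integral => v _; congr (_%:E); apply: eq_bigr => z _; rewrite tau_law.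
- move=> z; apply: measurable_sum => j; apply: measurable_funX;
  apply: measurable_funB => //.
  exact: (measurableT_comp (measurable_tnth j) (@measurable_decode _ _ _ _ p z)).
- by move=> z v; apply: sumr_ge0 => j _; exact: sqr_ge0.
Qed.

End risk.

Section grid_prior.
Context {R : realType} (d m : nat) (b : 'I_m -> nat) (p : @protocol R d m b).
Context (sigma : R) (N' : nat).
Local Notation Rd := (d.-tuple (measurableTypeR R)).
Let N := N'.+2.

Definition grid_point (k : {ffun 'I_d -> 'I_N}) : Rd :=
  [tuple (k j)%:R / N%:R | j < d].

Lemma grid_point_in_cube k : @unit_cube R d (grid_point k).
Proof.
move=> j; rewrite tnth_mktuple divr_ge0 //= ler_pdivrMr ?ltr0n // mul1r ler_nat.
exact: ltnW.
Qed.

Definition grid_law i (k : {ffun 'I_d -> 'I_N}) (y : (b i).-tuple bool) : R :=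
  message_prob (seed_law p i) (@encode _ _ _ _ p i) sigma (grid_point k) y.
Arguments grid_law : clear implicits.

(** The supremum dominates the grid average, and the bound for deterministic estimators is
    integrated over the decoder seed. *)
Lemma le_sup_risk (X : R) :
  (forall T, #|{ffun 'I_d -> 'I_N}|%:R * X <= grid_error grid_law T) ->
  (X%:E <= ereal_sup [set risk p sigma theta | theta in @unit_cube R d])%E.
Proof.
move=> h; set n : R := #|_|%:R in h; set S := ereal_sup _.
have n0 : 0 < n by rewrite ltr0n; apply/card_gt0P; exists 0.
have riskS k : (risk p sigma (grid_point k) <= S)%E.
  by apply: ereal_sup_ubound; exists (grid_point k) => //; exact: grid_point_in_cube.
have prod0 k (z : transcript b) : 0 <= \prod_i grid_law i k (z i).
  by apply: prodr_ge0 => i _; exact: message_prob_ge0.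
have dist0 (x y : Rd) : 0 <= sq_dist x y by apply: sumr_ge0 => j _; exact: sqr_ge0.
pose f (k : {ffun 'I_d -> 'I_N}) (v : dec_seed p) : R := \sum_(z : transcript b)
  (\prod_i grid_law i k (z i)) * sq_dist (decode z v) (grid_point k).
have f0 k v : 0 <= f k v by apply: sumr_ge0 => z _; exact: mulr_ge0.
have mf k : measurable_fun setT (f k).
  apply: measurable_sum => z; apply: measurable_funM => //.
  apply: measurable_sum => j; apply: measurable_funX; apply: measurable_funB => //.
  exact: (measurableT_comp (measurable_tnth j) (@measurable_decode _ _ _ _ p z)).
have rE k : risk p sigma (grid_point k) = (\int[dec_seed_law p]_v (f k v)%:E)%E.
  exact: riskE.
have risk0 k : (0 <= risk p sigma (grid_point k))%E.
  by rewrite rE; apply: integral_ge0 => v _; rewrite lee_fin.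
have total : ((n * X)%:E <= \sum_k risk p sigma (grid_point k))%E.
  apply: (@le_trans _ _ (\int[dec_seed_law p]_v (\sum_k f k v)%:E)%E); last first.
    under [leRHS]eq_bigr do rewrite rE.
    rewrite -ge0_integral_sum //; last 2 first.
    - by move=> k; exact/measurable_EFinP.
    - by move=> k v _; rewrite lee_fin.
    apply: eq_imp_le.
    by apply: eq_integral => v _; rewrite sumEFin.
  have [X0|X0] := lerP X 0.
    apply: (@le_trans _ _ 0%E).
      by rewrite lee_fin mulr_ge0_le0 // ltW.
    by apply: integral_ge0 => v _; rewrite lee_fin sumr_ge0.
  apply: (@le_trans _ _ (\int[dec_seed_law p]_v (n * X)%:E)%E).
    by rewrite integral_cst // [X in (_ * X)%E](probability_setT (dec_seed_law p))
      mule1.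
  apply: ge0_le_integral => //.
  - by move=> v _; rewrite lee_fin mulr_ge0 // ltW.
  - by apply/measurable_EFinP; exact: measurable_sum.
  move=> v _; rewrite lee_fin.
  apply: le_trans (h (fun z j => tnth (decode z v) j)) _.
  apply: eq_imp_le.
  apply: eq_bigr => k _; apply: eq_bigr => z _; congr (_ * _); apply: eq_bigr => j _.
  by rewrite tnth_mktuple.
(* A supremum below [X] would be finite, and [n] copies of it would contradict [total]. *)
rewrite leNgt; apply/negP => SX.
have S0 : (0 <= S)%E by apply: le_trans (risk0 0) (riskS 0).
have Sfin : S \is a fin_num by rewrite ge0_fin_numE // (lt_trans SX) // ltry.
have : ((n * X)%:E <= \sum_(k : {ffun 'I_d -> 'I_N}) (fine S)%:E)%E.
  apply: (le_trans total); apply: lee_sum => k _; by rewrite fineK.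
rewrite sumEFin lee_fin sumr_const -mulr_natl ler_pM2l // leNgt.
by rewrite -lte_fin fineK // SX.
Qed.

End grid_prior.

Section protocol_on_grid.
Context {R : realType} (d m : nat) (b : 'I_m -> nat) (p : @protocol R d m b).
Context (sigma : R) (s0 : 0 < sigma) (N' : nat).
Hypotheses (d0 : (0 < d)%N) (m0 : (0 < m)%N) (b0 : forall i, (0 < b i)%N).
Local Notation Rd := (d.-tuple (measurableTypeR R)).

Let N := N'.+2.
Let t : R := N%:R^-1 / sigma.
Hypothesis t01 : 0 <= t <= 1.
Context (K : R).
Hypotheses (KE : K = 2048 * expR 8) (K34 : 34 <= K).
Hypothesis tN : d%:R * m%:R * K * t ^+ 2 <= 1.

Let P := @grid_law R d m b p sigma N'.

Let thetas (k : {ffun 'I_d -> 'I_N}) j : Rd :=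
  [tuple tnth (@grid_point R d N' k) l + (if l == j then N%:R^-1 else 0) | l < d].

Let thetasE k j l :
  tnth (thetas k j) l = tnth (@grid_point R d N' k) l + (if l == j then N%:R^-1 else 0).
Proof. by rewrite tnth_mktuple. Qed.

Let P' i j (k : {ffun 'I_d -> 'I_N}) (y : (b i).-tuple bool) : R :=
  message_prob (seed_law p i) (@encode _ _ _ _ p i) sigma (thetas k j) y.

Let me i := @measurable_encode_preimage R d m b p i.

Let P0 i k y : 0 <= @P i k y. Proof. exact: message_prob_ge0. Qed.
Let P1 i k : \sum_y @P i k y = 1.
Proof. exact: (sum_message_prob (seed_law p i) (@me i)). Qed.
Let P'1 i j k : \sum_y @P' i j k y = 1.
Proof. exact: (sum_message_prob (seed_law p i) (@me i)). Qed.

Let PP' i j (k : {ffun 'I_d -> 'I_N}) y :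
  (k + grid_shift N' j) j != 0 -> @P i (k + grid_shift N' j) y = @P' i j k y.
Proof.
move=> k0.
suff E : @grid_point R d N' (k + grid_shift N' j) = thetas k j by rewrite /P /grid_law
  E.
apply: eq_from_tnth => l; rewrite !tnth_mktuple.
rewrite !ffunE; case: eqP => [->|_]; last by rewrite !addr0.
have : ((k j).+1 %% N)%N != 0%N.
  by move: k0; rewrite !ffunE eqxx -val_eqE /= modnDmr addn1.
have := ltn_ord (k j); rewrite -ltnS leq_eqVlt => /orP[/eqP[->]|h _].
  by rewrite modnn.
by rewrite /= modnDmr modn_small ?addn1 // -addn1 natrD mulrDl div1r.
Qed.

Let P'_ac i j k y : @P' i j k y = @P i k y * (1 + (@P' i j k y / @P i k y - 1)).
Proof. exact: (message_ratio (seed_law p i) (@me i) s0 t01 (thetasE k)). Qed.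

Let P'_chi i j k :
  \sum_y @P i k y * (@P' i j k y / @P i k y - 1) ^+ 2 <= 16 * t ^+ 2 + K * t ^+ 4.
Proof. by rewrite KE; exact: (message_chi_square_le (seed_law p i) (@me i) s0 t01
  (thetasE k)). Qed.

Let sum_P'_chi i k :
  \sum_j \sum_y @P i k y * (@P' i j k y / @P i k y - 1) ^+ 2 <=
  4 * t ^+ 2 * entropy (@P i k) + d%:R * (K * t ^+ 4).
Proof. by rewrite KE; exact: (sum_message_chi_square_le (seed_law p i) (@me i) s0 t01
  (thetasE k)). Qed.

Let n : R := #|{ffun 'I_d -> 'I_N}|%:R.
Let r : R := (\sum_(i < m) b i)%N%:R / d%:R.
Let m' : R := (\sum_(i < m) minn (b i) d)%N%:R / d%:R.
Let L : R := log2 (1 / sigma).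
Let c : R := (200 * expR 2)^-1.

Hypothesis lN : expR (r * ln 2 + ln 8 + 1) <= N%:R.
Hypothesis sN : 1 / sigma <= N%:R.

Let n0 : 0 < n. Proof. by rewrite ltr0n; apply/card_gt0P; exists 0. Qed.
Let dR : 1 <= d%:R :> R. Proof. by rewrite ler1n. Qed.

Lemma grid_error_regimes T :
  [/\ n * (c * 2 `^ (- 2 * r) * d%:R) <= grid_error P T,
      (L + 2 <= r -> sigma <= 1 ->
        n * (c * (d%:R * sigma ^+ 2 / (r - L))) <= grid_error P T) &
      n * (c * (d%:R * Num.min (sigma ^+ 2 / m') 1)) <= grid_error P T].
Proof.
have H0 := total_entropy_ge0 P0 P1.
have Hle := total_entropy_le P0 P1 T.
split.
- apply: (coding_regime dR n0 H0); apply: Hle.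
  by rewrite expR_gt0.
- move=> Lr s1; apply: (localized_regime dR n0 s0 H0 Lr s1).
    by apply: Hle; rewrite divr_gt0.
  exact: (error_ge_entropy s0 d0 m0 K34 tN P0 P1 P'1 PP' P'_ac P'_chi sum_P'_chi T).
- apply: (budget_regime dR n0 s0); last first.
    exact: (error_ge_budget s0 d0 m0 b0 K34 tN P0 P1 P'1 PP' P'_ac P'_chi sum_P'_chi T).
  (* A single machine already makes the sum of the [minn (b i) d] positive. *)
  rewrite ltr0n (bigD1 (Ordinal m0)) //= ltn_addr // leq_min b0 //.
Qed.

End protocol_on_grid.

(** * Choice of the grid and conclusion *)

Section resolution.
Context {R : realType}.

(** Any [N >= A * a + l] works: with [A >= 1] and [t = a / N], both [t] and [A * t] are at most 1,
    hence so is [A * t ^+ 2]. *)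
Lemma exists_grid_resolution (d m : nat) (sigma l K : R) :
  0 < sigma -> (1 <= d)%N -> (1 <= m)%N -> 1 <= K -> 0 <= l ->
  exists N' : nat, let t := N'.+2%:R^-1 / sigma in
  [/\ 0 <= t <= 1, d%:R * m%:R * K * t ^+ 2 <= 1, l <= N'.+2%:R & 1 / sigma <=
    N'.+2%:R].
Proof.
move=> s0 d1 m1 K1 l0; set A := d%:R * m%:R * K; set a := 1 / sigma.
have A1 : 1 <= A by rewrite !mulr_ege1 ?ler1n.
have a0 : 0 < a by rewrite divr_gt0.
have B0 : 0 <= A * a + l by rewrite addr_ge0 // mulr_ge0 // ?ltW //; lra.
exists (Num.Def.archi_bound (A * a + l)).
set N := _.+2; move=> t.
have BN : A * a + l <= N%:R.
  apply: le_trans (ltW (archi_boundP B0)) _.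
  by rewrite ler_nat /N; do 2 apply: leqW.
have aA : a <= A * a by rewrite ler_peMl // ltW.
have N0 : 0 < N%:R :> R by rewrite ltr0n.
have tE : t = a / N%:R by rewrite /t /a; field; rewrite !gt_eqF.
have t0 : 0 <= t by rewrite tE divr_ge0 // ltW.
have t1 : t <= 1 by rewrite tE ler_pdivrMr // mul1r; lra.
have At : A * t <= 1 by rewrite tE mulrA ler_pdivrMr // mul1r; lra.
split; [by rewrite t0| |lra|lra].
by rewrite expr2 mulrA mulr_ile1 // mulr_ge0 //; lra.
Qed.

End resolution.

Theorem theorem3 (R : realType) :
  exists c : R, 0 < c /\
    forall (sigma : R) (d m : nat) (b : 'I_m -> nat),
      0 < sigma -> (1 <= d)%N -> (1 <= m)%N -> (forall i, (1 <= b i)%N) ->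
      let r := (\sum_(i < m) b i)%N%:R / d%:R : R in
      let m' := (\sum_(i < m) minn (b i) d)%N%:R / d%:R : R in
      let L := log2 (1 / sigma) in
      let M := minimax_risk d b sigma in
      [/\ r < L + 2 ->
           ((c * 2 `^ (- 2 * r) * d%:R)%:E <= M)%E,
          L + 2 <= r < L + Num.max m' 2 ->
           ((c * (d%:R * sigma ^+ 2 / (r - L)))%:E <= M)%E
        & L + Num.max m' 2 <= r ->
           ((c * (d%:R * Num.min (sigma ^+ 2 / m') 1))%:E <= M)%E].
Proof.
exists (200 * expR 2)^-1; split; first by rewrite invr_gt0 mulr_gt0 // expR_gt0.
move=> sigma d m b s0 d1 m1 b1 r m' L M.
have [K KE] : exists K : R, K = 2048 * expR 8 by exists (2048 * expR 8).
have K34 : 34 <= K by rewrite KE; have := expR_ge1Dx (8 : R); lra.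
have K1 : 1 <= K by lra.
have [N' [t01 tN lN sN]] := exists_grid_resolution s0 d1 m1 K1 (expR_ge0 (r * ln 2 + ln 8 + 1)).
have regimes p := grid_error_regimes p s0 d1 m1 b1 t01 KE K34 tN lN sN.
have mM (X : R) : (forall p : @protocol R d m b, forall T,
    #|{ffun 'I_d -> 'I_N'.+2}|%:R * X <= grid_error (@grid_law R d m b p sigma N') T) ->
    (X%:E <= M)%E.
  by move=> h; apply: le_ereal_inf_tmp => _ [p ->]; exact: (le_sup_risk (h p)).
split.
- by move=> _; apply: mM => p T; have [] := regimes p T.
- move=> /andP[Lr rL]; apply: mM => p T; have [_ h _] := regimes p T; apply: h => //.
  have d0 : 0 < d%:R :> R by rewrite ltr0n.
  have m'r : m' <= r.
    by rewrite ler_pM2r ?invr_gt0 // ler_nat; apply: leq_sum => i _; exact: geq_minl.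
  (* The middle regime forces the maximum to be [m'], so [r < L + m' <= L + r]. Thus [L > 0], which
     gives [sigma <= 1]. *)
  have L0 : 0 < L by move: rL; rewrite /Num.max; case: ifP => _; lra.
  rewrite leNgt; apply/negP => s1; move: L0; rewrite ltNge => /negP; apply.
  rewrite /L /log2 pmulr_lle0; last by rewrite invr_gt0 ln_gt0 // ltr1n.
  by rewrite ln_le0 // ler_pdivrMr // mul1r ltW.
- by move=> _; apply: mM => p T; have [] := regimes p T.
Qed.
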